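(* For every integer $n\geq 4$, the full arc complex $\mathcal{A}(\mathcal{M}_n)$ of the non-orientable crown $\mathcal{M}_n$ with $n$ vertices is not strongly collapsible.
   Context: Surface. For $n\ge 1$, the non-orientable crown $\mathcal{M}_n$ is the Möbius strip with $n$ distinct marked points (vertices) on its boundary circle, labeled $1,\dots,n$ in cyclic order. The portion of the boundary between two consecutive vertices is an edge. Arcs. A simple arc is an arc in the surface whose two endpoints are vertices (possibly the same vertex), which is embedded except that its endpoints may coincide, and whose interior avoids the boundary. Homotopies of arcs are relative to endpoints. An arc is trivial if it is homotopic, relative to its endpoints, to a vertex or to an edge. Only simple non-trivial arcs are considered. Two homotopy classes are disjoint if they have representatives that are disjoint (except possibly at endpoints). Arc complex. The full arc complex $\mathcal{A}(\mathcal{M}_n)$ is the simplicial complex whose 0-simplices are the homotopy classes of all simple non-trivial arcs, and whose $k$-simplices ($k\ge1$) are the sets of $k+1$ pairwise disjoint and distinct homotopy classes. Strong collapse. A 0-simplex $v$ of a simplicial complex $X$ is vertex-dominated if there is another 0-simplex $v'$ such that the link of $v$ in $X$ is a join $v'*L$ for some subcomplex $L$ of $X$ (equivalently, every maximal simplex containing $v$ contains $v'$; $L$ may be the empty complex). In that case $X$ strongly collapses onto $X\smallsetminus\{v\}:=\{\eta\in X\mid v\notin\eta\}$. A finite complex is strongly collapsible if some finite sequence of strong collapses reduces it to a single 0-simplex. *)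

(* Defs.v *)
From HB Require Import structures.
From mathcomp Require Import all_boot all_order all_algebra generic_quotient.
From mathcomp Require Import all_classical all_reals all_analysis.
Import Order.TTheory GRing.Theory Num.Theory.
Import numFieldNormedType.Exports.

Set Implicit Arguments.
Unset Strict Implicit.
Unset Printing Implicit Defensive.

Local Open Scope classical_set_scope.
Local Open Scope ring_scope.
Local Open Scope quotient_scope.

(** Abstract simplicial complexes: a complex is the set of its nonempty
    simplices, so that [set0] is the empty complex. *)

Section SimplicialComplexes.
Context {V : Type}.
Implicit Types (X K L : set (set V)) (v : V) (s : set V).

Definition simplicial_complex X :=
  (forall s, X s -> finite_set s /\ s !=set0) /\
  (forall s s', X s -> s' `<=` s -> s' !=set0 -> X s').

Definition subcomplex L X := simplicial_complex L /\ L `<=` X.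

Definition vertices X : set V := [set v | X [set v]].

Definition link X v : set (set V) :=
  [set s | [/\ X s, ~ s v & X (v |` s)]].

(* The terms [K s] and [L s] account for the empty simplex of the other
   factor. *)
Definition join K L : set (set V) :=
  [set s | [\/ K s, L s | exists a b, [/\ K a, L b & s = a `|` b]]].

(* The second condition on [L] says that the join is well defined: its two
   factors have no vertex in common. *)
Definition vertex_dominated X v :=
  X [set v] /\
  exists v' L, [/\ X [set v'], v' <> v, subcomplex L X, ~ vertices L v' &
                   link X v = join [set [set v']] L].

Definition deletion X v : set (set V) := [set s | X s /\ ~ s v].

Inductive strongly_collapsible X : Prop :=
| StrongPoint v of X = [set [set v]]
| StrongStep v of vertex_dominated X v & strongly_collapsible (deletion X v).

End SimplicialComplexes.

(** The open Möbius band, i.e., the quotient of the plane by the group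
    generated by the glide reflection (x, y) |-> (x + 1, - y). *)

Section MobiusBand.
Variable R : realType.

Definition glide (k : int) (p : R * R) : R * R := (p.1 + k%:~R, (-1) ^ k * p.2).

Definition glide_rel (p q : R * R) : bool := `[< exists k, q = glide k p >].

Lemma glide_rel_refl : reflexive glide_rel.
Proof.
by move=> [x y]; apply/asboolP; exists 0; rewrite /glide /= addr0 expr0z mul1r.
Qed.

Lemma glide_relW p q : glide_rel p q -> glide_rel q p.
Proof.
case: p => x y /asboolP[k ->]; apply/asboolP; exists (- k).
by rewrite /glide /= mulrNz addrK mulrA -expfzDr ?oppr_eq0 ?oner_eq0// addNr
  expr0z mul1r.
Qed.

Lemma glide_rel_sym : symmetric glide_rel.
Proof. by move=> p q; apply/idP/idP; exact: glide_relW. Qed.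

Lemma glide_rel_trans : transitive glide_rel.
Proof.
move=> q [x y] r /asboolP[k ->] /asboolP[l ->]; apply/asboolP; exists (k + l).
rewrite /glide /= -addrA -mulrzDr (mulrA (_ ^ l)) -expfzDr ?oppr_eq0 ?oner_eq0//.
by rewrite (addrC l).
Qed.

Definition glide_equiv :=
  EquivRel glide_rel glide_rel_refl glide_rel_sym glide_rel_trans.

Definition mobius := {eq_quot glide_equiv}.

HB.instance Definition _ :=
  Topological.copy mobius (quotient_topology mobius).
HB.instance Definition _ := Quotient.on mobius.

Definition mobius_pt (p : R * R) : mobius := \pi_mobius p.

(* The (compact) Möbius strip |y| <= 1 and its boundary circle |y| = 1. *)
Definition strip : set mobius := [set mobius_pt p | p in [set p | `|p.2| <= 1]].
Definition boundary : set mobius :=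
  [set mobius_pt p | p in [set p | `|p.2| = 1]].

(* As (x, -1) ~ (x + 1, 1) and (x, 1) ~ (x + 2, 1), this induces a bijection
   from R / 2Z onto the boundary circle. *)
Definition boundary_pt (x : R) : mobius := mobius_pt (x, 1).

End MobiusBand.

(** The crown, with arcs as paths parametrized by [0, 1]; only the values of a
    path on [0, 1] are relevant. *)

Section Crown.
Variables (R : realType) (n : nat).
(* the i-th vertex is [boundary_pt (t i)] *)
Variable t : 'I_n -> R.

Definition cyclic_marking :=
  (forall i, 0 <= t i < 2) /\ (forall i j : 'I_n, (i < j)%N -> t i < t j).

Local Notation I01 := (`[0, 1]%classic : set R).

(* Parameters of all lifts of the vertices to the universal cover of the
   boundary circle. *)
Definition marked : set R := [set x | exists i (k : int), x = t i + 2 * k%:~R].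

Definition crown_vertex : set (mobius R) := [set boundary_pt x | x in marked].

Implicit Types (g h : R -> mobius R) (A B : set (R -> mobius R)).

Definition reverse g : R -> mobius R := fun s => g (1 - s).

Definition homotopic g h :=
  exists H : R * R -> mobius R,
    [/\ {within I01 `*` I01, continuous H},
        H @` (I01 `*` I01) `<=` @strip R,
        forall s, I01 s -> H (0, s) = g s /\ H (1, s) = h s
      & forall r, I01 r -> H (r, 0) = g 0 /\ H (r, 1) = g 1].

(* Arcs are not oriented. *)
Definition arc_homotopic g h := homotopic g h \/ homotopic g (reverse h).

Definition simple_arc g :=
  [/\ {within I01, continuous g} /\ g @` I01 `<=` @strip R,
      crown_vertex (g 0) /\ crown_vertex (g 1),
      forall r s, I01 r -> I01 s -> r < s -> g r = g s -> r = 0 /\ s = 1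
    & forall s : R, 0 < s < 1 -> ~ @boundary R (g s)].

(* For n = 1 there is a single edge, joining the vertex to itself. *)
Definition crown_edge g :=
  exists a b, [/\ marked a, marked b, a < b, (forall x, a < x < b -> ~ marked x)
    & forall s, I01 s -> g s = boundary_pt (a + s * (b - a))].

Definition trivial_arc g :=
  (exists2 v, crown_vertex v & homotopic g (fun=> v)) \/
  (exists2 e, crown_edge e & arc_homotopic g e).

Definition arc_class g : set (R -> mobius R) :=
  [set h | simple_arc h /\ arc_homotopic g h].

Definition arc_classes : set (set (R -> mobius R)) :=
  [set arc_class g | g in [set g | simple_arc g /\ ~ trivial_arc g]].

Definition disjoint_arcs g h :=
  forall r s, I01 r -> I01 s -> g r = h s ->
    (r = 0 \/ r = 1) /\ (s = 0 \/ s = 1).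

Definition disjoint_classes A B :=
  exists g h, [/\ A g, B h & disjoint_arcs g h].

Definition arc_complex : set (set (set (R -> mobius R))) :=
  [set s | [/\ finite_set s, s !=set0, s `<=` arc_classes &
    forall A B, s A -> s B -> A <> B -> disjoint_classes A B]].

End Crown.

(* Main.v *)
Require Import Defs.
From mathcomp Require Import all_boot all_order all_algebra generic_quotient.
From mathcomp Require Import all_classical all_reals all_analysis.
From mathcomp Require Import ring lra zify.
Import Order.TTheory GRing.Theory Num.Theory.
Import numFieldNormedType.Exports.

Set Implicit Arguments.
Unset Strict Implicit.
Unset Printing Implicit Defensive.

Local Open Scope classical_set_scope.
Local Open Scope ring_scope.
Local Open Scope quotient_scope.

(** Simplices of the arc complex are the finite sets of pairwise disjoint
    classes, so a vertex is dominated by another one exactly when every class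
    disjoint from the first is equal to, or disjoint from, the second.  The
    theorem holds because some vertices are never dominated, whatever has been
    removed before: there is a set [core] of at least two classes such that, for
    every [v] in [core] and every class [v'] other than [v], some member of
    [core] is disjoint from [v] but neither equal to nor disjoint from [v'].  By
    induction on a sequence of strong collapses no member of [core] is ever
    removed ([core_not_strongly_collapsible]), so no sequence ends at a point.

    Classes are described in the plane, the universal cover of the open Möbius
    band, by the endpoints of a lift ([joins]).  A lift starting on the line
    y = 1 at a marked abscissa [a] ends either on the same line, at [b], or on
    the line y = -1, at [c - 1] for a marked [c], since (c - 1, -1) lies over
    the same vertex as (c, 1).  The arc is then a cap, cutting off the vertices
    strictly between [a] and [b], or a crossing arc, which passes once through
    the crosscap and has the vertices [a] and [c] as its ends.  The core
    consists of the crossing arcs and of the ears, the caps that cut off a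
    single vertex.  Here is why its members are not dominated.

    - A cap cutting off a vertex [x] meets every crossing arc that ends at [x]
      ([disjoint_cap_cross]), and a crossing arc [a c] is disjoint from the
      crossing arc [a x].  So no crossing arc is dominated by a cap.
    - A crossing arc disjoint from the crossing loop at [x] ends at [x]
      ([compatible_loop]).  The loops at [a] and at [c] are disjoint from
      the crossing arc [a c]; so only [a c] itself could dominate [a c] when
      these vertices differ.  When they agree, a dominating crossing arc goes
      from [a] to some [g] other than [a], and meets the ear around [g], which is
      disjoint from the loop at [a].
    - The ear around [l] is disjoint from the crossing loops at all the other
      vertices.  There are at least three of them, because n >= 4, while a
      crossing arc has two ends only: it cannot dominate the ear
      ([fresh_vertex]).  Neither can a cap, which would cut off [l] alone.

    These combinatorial facts rest on three topological ones.  Homotopic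
    arcs have lifts with the same endpoints and conversely ([homotopic_joins],
    [joins_homotopic]).  The functions cos 2 pi x, sin 2 pi x, y cos pi x and
    y sin pi x are invariant under the glide reflection, so that lifting a path or a
    homotopy amounts to finding an angle function for a circle-valued map on
    the square ([lift_circle]).  Two paths in a strip whose endpoints are linked
    must meet ([crossing_lines], [crossing_cap]): otherwise the difference of
    the two paths has an angle function on the square, which the position of the
    endpoints forces to turn once along the boundary.  Finally segments and
    parabolas realize the members of the core and their disjointness. *)

(** * Continuity of explicit real functions *)

Section Continuity.
Context {T U V : topologicalType} {R : realType}.
Implicit Types f g : T -> R.

Lemma cont_cst (W : topologicalType) (f : T -> W) c : f = (fun=> c) -> continuous f.
Proof. by move=> -> x; exact: cvg_cst. Qed.

Lemma cont_id (f : T -> T) : f = id -> continuous f.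
Proof. by move=> -> x; exact: cvg_id. Qed.

Lemma cont_comp (h : T -> U) (k : U -> V) :
  continuous h -> continuous k -> continuous (fun x => k (h x)).
Proof. by move=> ch ck x; apply: continuous_comp; [exact: ch|exact: ck]. Qed.

Lemma cont_pair (h : T -> U) (k : T -> V) :
  continuous h -> continuous k -> continuous (fun x => (h x, k x)).
Proof. by move=> ch ck x; apply: cvg_pair; [exact: ch|exact: ck]. Qed.

Lemma cont_fst (f : T * U -> T) : f = fst -> continuous f.
Proof. by move=> -> x; exact: cvg_fst. Qed.

Lemma cont_snd (f : T * U -> U) : f = snd -> continuous f.
Proof. by move=> -> x; exact: cvg_snd. Qed.

Lemma contD f g : continuous f -> continuous g -> continuous (fun x => f x + g x).
Proof. by move=> cf cg x; apply: cvgD; [exact: cf|exact: cg]. Qed.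

Lemma contN f : continuous f -> continuous (fun x => - f x).
Proof. by move=> cf x; apply: cvgN; exact: cf. Qed.

Lemma contM f g : continuous f -> continuous g -> continuous (fun x => f x * g x).
Proof. by move=> cf cg x; apply: cvgM; [exact: cf|exact: cg]. Qed.

Lemma contV f : (forall x, f x != 0) -> continuous f ->
  continuous (fun x => (f x)^-1).
Proof. by move=> f0 cf x; apply: cvgV => //; exact: cf. Qed.

Lemma contX f n : continuous f -> continuous (fun x => f x ^+ n).
Proof.
move=> cf; elim: n => [|n ih].
  by under eq_fun do rewrite expr0; exact: (@cont_cst _ (fun=> 1 : R) 1 erefl).
by under eq_fun do rewrite exprS; exact: contM.
Qed.

Lemma cont_norm f : continuous f -> continuous (fun x => `|f x|).
Proof. by move=> cf x; apply: cvg_norm; exact: cf. Qed.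
End Continuity.

(** The head symbol of the function selects the lemma: leaving the choice to
    unification is very slow on constant functions. *)
Ltac cont := lazymatch goal with
  | |- forall t, continuous_at t (fun x => (@?f x + @?g x)%R) =>
      apply: (@contD _ _ f g); cont
  | |- forall t, continuous_at t (fun x => (@?f x * @?g x)%R) =>
      apply: (@contM _ _ f g); cont
  | |- forall t, continuous_at t (fun x => (- @?f x)%R) =>
      apply: (@contN _ _ f); cont
  | |- forall t, continuous_at t (fun x => (@?f x ^+ ?n)%R) =>
      apply: (@contX _ _ f n); cont
  | |- forall t, continuous_at t (fun x => `|@?f x|%R) =>
      apply: (@cont_norm _ _ f); cont
  | |- forall t, continuous_at t (fun x => (@?f x, @?g x)) =>
      apply: (@cont_pair _ _ _ f g); cont
  | |- forall t, continuous_at t (fun x : ?T => x) =>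
      first [exact: (@cont_id _ (fun x : T => x) erefl)
            | exact: (cont_id erefl) | by move=> ?; exact: cvg_id | idtac]
  | |- forall t, continuous_at t (fun x : ?T => x.1) =>
      first [exact: (@cont_fst _ _ (fun x : T => x.1) erefl)
            | exact: (cont_fst erefl) | by move=> ?; exact: cvg_fst | idtac]
  | |- forall t, continuous_at t (fun x : ?T => x.2) =>
      first [exact: (@cont_snd _ _ (fun x : T => x.2) erefl)
            | exact: (cont_snd erefl) | by move=> ?; exact: cvg_snd | idtac]
  | |- forall t, continuous_at t (fun x => cos (@?f x)) =>
      apply: (@cont_comp _ _ _ f (@cos _)); [cont|exact: continuous_cos]
  | |- forall t, continuous_at t (fun x => sin (@?f x)) =>
      apply: (@cont_comp _ _ _ f (@sin _)); [cont|exact: continuous_sin]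
  | |- forall t, continuous_at t (fun x : ?T => ?c) =>
      first [assumption | exact: (@cont_cst _ _ (fun _ : T => c) c erefl) | idtac]
  | _ => try assumption
  end.

(** * Angle functions for circle-valued maps on the square *)

Section CircleLift.
Context {R : realType}.
Implicit Types (u v : R * R -> R) (p q : R * R).

Local Notation I01 := (`[0, 1]%classic : set R).

Lemma unit_itv0 : I01 0.
Proof. by rewrite /= in_itv/= lexx ler01. Qed.

Lemma unit_itv1 : I01 1.
Proof. by rewrite /= in_itv/= lexx ler01. Qed.

(** Precomposing with this retraction onto the unit interval turns continuity
    within the interval into continuity everywhere. *)
Definition clamp (x : R) : R := (`|x| - `|x - 1| + 1) / 2.

Lemma clamp_id x : 0 <= x <= 1 -> clamp x = x.
Proof. by move=> ?; rewrite /clamp ger0_norm ?ler0_norm; lra. Qed.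

Lemma clamp01 x : 0 <= clamp x <= 1.
Proof.
rewrite /clamp; case: (leP 0 x) => ?; case: (leP 0 (x - 1)) => ?.
- by rewrite !ger0_norm; lra.
- by rewrite ger0_norm ?ltr0_norm; lra.
- by lra.
- by rewrite !ltr0_norm; lra.
Qed.

Lemma continuous_clamp : continuous clamp.
Proof.
by rewrite /clamp; cont.
Qed.

Definition clamp2 p : R * R := (clamp p.1, clamp p.2).

Lemma continuous_clamp2 : continuous clamp2.
Proof.
rewrite /clamp2; cont; apply: (@cont_comp _ _ _ _ clamp _ continuous_clamp).
  exact: (@cont_fst _ _ (fun p : R * R => p.1)).
exact: (@cont_snd _ _ (fun p : R * R => p.2)).
Qed.

Lemma cos_atan_div (w z : R) : 0 < z -> z ^+ 2 + w ^+ 2 = 1 ->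
  cos (atan (w / z)) = z /\ sin (atan (w / z)) = w.
Proof.
move=> z0 wz1.
have cz : cos (atan (w / z)) = z.
  rewrite cos_atan; have -> : 1 + (w / z) ^+ 2 = (z^-1) ^+ 2.
    have : z != 0 by lra.
    move=> ?; rewrite -[1 in LHS](@divff _ (z ^+ 2)) ?expf_neq0//.
    by rewrite !expr_div_n -mulrDl wz1 exprVn mul1r.
  by rewrite sqrtr_sqr ger0_norm ?invrK// invr_ge0 ltW.
split=> //; have := atanK (w / z); rewrite /tan cz.
by move=> /(congr1 ( *%R^~ z)); rewrite !divfK//; lra.
Qed.

Lemma uniform_on_square u (e : R) : continuous u -> 0 < e ->
  \forall N \near \oo, forall p, (I01 `*` I01) p -> forall q, ball p (N.+1%:R^-1) q ->
    `|u p - u q| < e.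
Proof.
move=> cu e0.
have /compact_near_coveringP : compact (I01 `*` I01 : set (R * R)).
  by apply: compact_setX; exact: segment_compact.
move=> /(_ nat \oo (fun N p => forall q, ball p (N.+1%:R^-1) q -> `|u p - u q| < e)).
apply => p _.
have /cvgrPdist_lt/(_ (e / 2)) := cu p; move=> /(_ ltac:(lra)) /nbhs_ballP[d /= d0 ud].
near=> q N => /= r qr.
have pq : ball p (d / 2) q by near: q; apply: nbhsx_ballx; lra.
have Nd : (N.+1%:R^-1 : R) < d / 2.
  near: N; have d20 : 0 < d / 2 by lra.
  exact: near_infty_natSinv_lt (PosNum d20).
rewrite (_ : u q - u r = (u p - u r) - (u p - u q)); last by ring.
apply: le_lt_trans (ler_normB _ _) _; rewrite [ltRHS](splitr e); apply: ltrD; apply: ud.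
  by apply: (@ball_split _ _ q) => //; apply: le_ball qr; exact: ltW.
by apply: le_ball pq; lra.
Unshelve. all: by end_near. Qed.

Lemma exists_angle (x y : R) : x ^+ 2 + y ^+ 2 = 1 ->
  exists a, cos a = x /\ sin a = y.
Proof.
move=> xy1; have x1 : -1 <= x <= 1 by nra.
have s : sin (acos x) = `|y|.
  by rewrite sin_acos// -xy1 addrC addKr sqrtr_sqr.
have [y0|y0] := leP 0 y.
  by exists (acos x); rewrite acosK ?in_itv// s ger0_norm.
by exists (- acos x); rewrite cosN sinN acosK ?in_itv// s ltr0_norm// opprK.
Qed.

(** Along the ray from the origin to [p], subdivided so finely that [(u, v)]
    turns by less than a right angle at each step, the angle at [p] is the angle
    at the origin plus the sum of the steps, each of which is an arctangent
    depending continuously on [p]. *)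
Lemma lift_circle u v : continuous u -> continuous v ->
    (forall p, (I01 `*` I01) p -> u p ^+ 2 + v p ^+ 2 = 1) ->
  exists2 a : R * R -> R, continuous a &
    forall p, (I01 `*` I01) p -> cos (a p) = u p /\ sin (a p) = v p.
Proof.
move=> cu cv uv1.
have [N [uN vN]] : exists N : nat,
    (forall p, (I01 `*` I01) p ->
       forall q, ball p (N.+1%:R^-1) q -> `|u p - u q| < 1) /\
    (forall p, (I01 `*` I01) p ->
       forall q, ball p (N.+1%:R^-1) q -> `|v p - v q| < 1).
  have   := @filterI _ _ _ _ _ (uniform_on_square cu ltr01) (uniform_on_square cv ltr01).
  by move=> /(_ _) /filter_ex[N HN]; exists N.
(* N.+2 subdivisions, for the balls of radius 1 / N.+1 are open. *)
pose c (k : nat) p : R * R :=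
  (k%:R / N.+2%:R * clamp p.1, k%:R / N.+2%:R * clamp p.2).
have cc k : continuous (c k).
  have c2 := continuous_clamp2; rewrite /c; cont.
    exact: (@cont_comp _ _ _ clamp2 fst c2 (@cont_fst R R fst erefl)).
  exact: (@cont_comp _ _ _ clamp2 snd c2 (@cont_snd R R snd erefl)).
have cI k p : (k <= N.+2)%N -> (I01 `*` I01) (c k p).
  move=> kN; have : 0 <= (k%:R / N.+2%:R : R) <= 1.
    by apply/andP; split; [exact: divr_ge0|rewrite ler_pdivrMr// mul1r ler_nat].
  case/andP=> k0 k1; have /andP[p0 p1] := clamp01 p.1; have /andP[q0 q1] := clamp01 p.2.
  by split; rewrite /= in_itv/= mulr_ge0//= mulr_ile1.
have cball k p : ball (c k p) (N.+1%:R^-1) (c k.+1 p).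
  have NN : (N.+2%:R^-1 : R) < N.+1%:R^-1 by rewrite ltf_pV2 ?posrE// ltr_nat.
  have N0 : 0 < (N.+2%:R^-1 : R) by rewrite invr_gt0.
  have d x : k%:R / N.+2%:R * x - k.+1%:R / N.+2%:R * x = - (N.+2%:R^-1 * x) :> R.
    by rewrite -mulrBl -mulrBl -natr1 opprD addrA subrr add0r mulN1r mulNr.
  have /andP[p0 p1] := clamp01 p.1; have /andP[q0 q1] := clamp01 p.2.
  have small x : 0 <= x -> x <= 1 -> `|N.+2%:R^-1 * x| < (N.+1%:R^-1 : R).
    move=> x0 x1; rewrite ger0_norm ?mulr_ge0// ?(ltW N0)//.
    by apply: (@le_lt_trans _ _ N.+2%:R^-1) => //; rewrite ler_piMr// ltW.
  by split; rewrite /ball/= d normrN; exact: small.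
suff /(_ N.+2 (leqnn _))[a ca a_lift] : forall m, (m <= N.+2)%N ->
    exists2 a : R * R -> R, continuous a &
    forall p, cos (a p) = u (c m p) /\ sin (a p) = v (c m p).
  exists a => // p [/= p1 p2]; rewrite !in_itv/= in p1 p2.
  suff cp : c N.+2 p = p by have := a_lift p; rewrite cp.
  by rewrite /c divff// !mul1r !clamp_id//; case: p {p1 p2}.
elim=> [_|m ih mN].
  have [|a [ua va]] := @exists_angle (u (0, 0)) (v (0, 0)).
    by apply: uv1; split; rewrite /= in_itv/= lexx ler01.
  exists (fun=> a); first exact: cont_cst.
  by move=> p; rewrite /c !mul0r ua va.
have [a ca a_lift] := ih (ltnW mN).
(* Cosine and sine of the step from c m p to c m.+1 p. *)
pose z p := u (c m p) * u (c m.+1 p) + v (c m p) * v (c m.+1 p).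
pose w p := u (c m p) * v (c m.+1 p) - v (c m p) * u (c m.+1 p).
have cuc k : continuous (fun p => u (c k p)) by apply: cont_comp.
have cvc k : continuous (fun p => v (c k p)) by apply: cont_comp.
have z0 p : 0 < z p.
  have := uN _ (cI m p (ltnW mN)) _ (cball m p).
  have := vN _ (cI m p (ltnW mN)) _ (cball m p).
  rewrite !ltr_norml => /andP[? ?] /andP[? ?].
  by have := uv1 _ (cI m p (ltnW mN)); have := uv1 _ (cI m.+1 p mN); rewrite /z; nra.
have zw1 p : z p ^+ 2 + w p ^+ 2 = 1.
  have -> : z p ^+ 2 + w p ^+ 2 =
    (u (c m p) ^+ 2 + v (c m p) ^+ 2) * (u (c m.+1 p) ^+ 2 + v (c m.+1 p) ^+ 2).
    by rewrite /z /w; ring.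
  by rewrite !uv1 ?mulr1//; apply: cI => //; exact: ltnW.
exists (fun p => a p + atan (w p / z p)).
  apply: contD => //; apply: (@cont_comp _ _ _ (fun p => w p / z p) (@atan R));
    last by move=> x; exact: continuous_atan.
  apply: contM; first by rewrite /w; cont.
  by apply: contV; [move=> p; rewrite gt_eqF|rewrite /z; cont].
move=> p; have [cz sw] := cos_atan_div (z0 p) (zw1 p); have [ua va] := a_lift p.
rewrite cosD sinD cz sw ua va /z /w; have := uv1 _ (cI m p (ltnW mN)).
move: (u (c m p)) (v (c m p)) (u (c m.+1 p)) (v (c m.+1 p)) => x y x' y' xy1.
split.
  by rewrite -[RHS]mul1r -xy1; ring.
by rewrite -[RHS]mul1r -xy1; ring.
Qed.
End CircleLift.

(** * Angles modulo a full turn *)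

Section Trigo.
Context {R : realType}.
Implicit Types (a b : R) (k : int).

Lemma signz_sqr k : ((-1) ^ k : R) ^+ 2 = 1.
Proof. by rewrite expr2 -exprzMl ?unitrN1// mulrNN mulr1 exp1rz. Qed.

Lemma signzP k : ((-1) ^ k : R) = 1 \/ ((-1) ^ k : R) = - 1.
Proof.
have /eqP := signz_sqr k; rewrite sqrf_eq1 => /orP[]/eqP ->; [by left|by right].
Qed.

Lemma norm_signz k : `|(-1) ^ k : R| = 1.
Proof. by case: (signzP k) => ->; rewrite ?normrN normr1. Qed.

Lemma cosDpiz a k : cos (a + pi * k%:~R) = (-1) ^ k * cos a.
Proof.
have nat_case b (n : nat) : cos (b + pi * n%:R) = (-1) ^+ n * cos b :> R.
  by rewrite mulr_natr alternatingn//; exact: cosDpi.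
case: k => n; first by rewrite nat_case.
rewrite NegzE -[a in RHS](subrK (pi * n.+1%:R)) nat_case mulrA -invr_expz -exprnP.
by rewrite mulVf ?expf_neq0 ?oppr_eq0 ?oner_eq0// mul1r mulrNz mulrN.
Qed.

Lemma sinDpiz a k : sin (a + pi * k%:~R) = (-1) ^ k * sin a.
Proof.
have := cosDpiz (a - pi / 2) k.
by rewrite cosBpihalf (_ : _ + _ = a + pi * k%:~R - pi / 2) ?cosBpihalf//; ring.
Qed.

Lemma cos_eq1 a : cos a = 1 -> exists k, a = pi * (2 * k%:~R).
Proof.
move=> ca; exists (Num.floor (a / (2 * pi))).
have p0 := pi_gt0 R.
set k := Num.floor _; pose b := a - pi * (2 * k%:~R).
have b0 : 0 <= b.
  have := ge_floor (a / (2 * pi)); rewrite -/k ler_pdivlMr; last lra.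
  by rewrite /b; lra.
have b2 : b < 2 * pi.
  have := lt_succ_floor (a / (2 * pi)); rewrite -/k ltr_pdivrMr; last lra.
  by rewrite intrD /b; lra.
have cb : cos b = 1.
  rewrite /b (_ : a - _ = a + pi * (- (2 * k))%:~R); last by rewrite mulrNz intrM; ring.
  rewrite cosDpiz ca mulr1 (_ : - (2 * k) = - k + - k); last by lia.
  by rewrite expfzDr ?oppr_eq0 ?oner_eq0// -expr2 signz_sqr.
have [b0'|] := eqVneq b 0; first by move: b0'; rewrite /b; lra.
move=> bn0; have : 0 < sin (b / 2) by apply: sin_gt0_pi; lra.
have := cos_mulr2n (b / 2); rewrite (_ : b / 2 *+ 2 = b) ?cb ?cos2sin2; last first.
  by rewrite -mulr_natr divfK.
by move: (sin _) => x; nra.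
Qed.

Lemma same_angle a b : cos a = cos b -> sin a = sin b ->
  exists k, a = b + pi * (2 * k%:~R).
Proof.
move=> cab sab; have [k kE] : exists k, a - b = pi * (2 * k%:~R).
  by apply: cos_eq1; rewrite cosB cab sab -!expr2 cos2Dsin2.
by exists k; rewrite -kE; ring.
Qed.

(** By the intermediate value theorem, a half-integer would be reached between two
    different integers. *)
Lemma int_valued_cst (f : R -> R) : continuous f ->
  (forall s, 0 <= s <= 1 -> exists k : int, f s = k%:~R) ->
  forall s, 0 <= s <= 1 -> f s = f 0.
Proof.
move=> cf fZ s s01; apply/eqP; apply: contraT => fs.
have [k kE] := fZ 0 ltac:(rewrite lexx ler01//).
have [l lE] := fZ s s01.
pose v : R := (Num.min k l)%:~R + 2^-1.
have kl : k != l by apply: contraNneq fs => kl; rewrite kE lE kl.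
have /andP[s0 s1] := s01.
have [|c] := @IVT R f 0 s v s0 (continuous_subspaceT cf).
- have h : (k + 1 <= l) || (l + 1 <= k) by lia.
  rewrite kE lE /v; case/orP: h => h.
    have : ((k + 1)%:~R : R) <= l%:~R by rewrite ler_int.
    rewrite (_ : Num.min k l = k) ?intrD; last by apply/min_idPl; lia.
    by move=> ?; rewrite ge_min le_max; apply/andP; split; apply/orP; [left|right]; lra.
  have : ((l + 1)%:~R : R) <= k%:~R by rewrite ler_int.
  rewrite (_ : Num.min k l = l) ?intrD; last by apply/min_idPr; lia.
  by move=> ?; rewrite ge_min le_max; apply/andP; split; apply/orP; [right|left]; lra.
- rewrite in_itv/= => /andP[c0 cs]; have [|m ->] := fZ c.
    by rewrite c0 (le_trans cs).
  move=> /(congr1 (fun x => 2 * x)); rewrite /v mulrDr divff// => /eqP.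
  rewrite -!(intrM _ 2) -(intrD _ _ 1) eqr_int => /eqP; lia.
Qed.
End Trigo.

(** * Lifting paths and homotopies to the plane *)

Section Covering.
Context {R : realType}.
Implicit Types (p q : R * R) (k l : int) (m : mobius R).
Local Notation I01 := (`[0, 1]%classic : set R).

Lemma mobius_ptP p q : mobius_pt p = mobius_pt q <-> exists k, q = glide k p.
Proof.
split=> [/eqmodP/asboolP[k ->]|[k kE]]; first by exists k.
by apply/eqmodP/asboolP; exists k.
Qed.

Lemma mobius_pt_glide k p : mobius_pt (glide k p) = mobius_pt p.
Proof. by apply/esym/mobius_ptP; exists k. Qed.

Lemma mobius_ptE m : exists p, m = mobius_pt p.
Proof. by exists (repr m); rewrite /mobius_pt reprK. Qed.

Lemma continuous_mobius_pt : continuous (@mobius_pt R).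
Proof. exact: pi_continuous. Qed.

Lemma glideD k l p : glide k (glide l p) = glide (k + l) p.
Proof.
rewrite /glide /= mulrA -expfzDr ?oppr_eq0 ?oner_eq0//.
by rewrite -addrA -intrD (addrC l).
Qed.

Lemma glide0 p : glide 0 p = p.
Proof. by case: p => x y; rewrite /glide /= addr0 expr0z mul1r. Qed.

Lemma glideK k p : glide (- k) (glide k p) = p.
Proof. by rewrite glideD addNr glide0. Qed.

Lemma continuous_glide k : continuous (@glide R k).
Proof.
rewrite /glide; cont.
Qed.

Lemma continuous_invariant (f : R * R -> R) : continuous f ->
    (forall p, f (glide 1 p) = f p) ->
  exists2 F : mobius R -> R, continuous F & forall p, F (mobius_pt p) = f p.
Proof.
move=> cf f1; have fk k p : f (glide k p) = f p.
  have fn (n : nat) q : f (glide n q) = f q.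
    elim: n => [|n ih]; first by rewrite glide0.
    by rewrite -[n.+1]add1n PoszD -glideD f1.
  case: k => n; first exact: fn.
  by rewrite -(fn n.+1) glideD NegzE addrN glide0.
have fpi p q : mobius_pt p = mobius_pt q -> f p = f q.
  by move=> /mobius_ptP[k ->]; rewrite fk.
exists (f \o (repr : mobius R -> R * R)).
  apply: repr_comp_continuous => // p q /eqP pq.
  by apply/eqP; exact: fpi.
by move=> p /=; apply: fpi; rewrite /mobius_pt reprK.
Qed.

Lemma stripE p : strip (mobius_pt p) = (`|p.2| <= 1).
Proof.
apply/propext; split=> [[q /= q1 /mobius_ptP[k ->]]|p1]; last by exists p.
by rewrite /= normrM norm_signz mul1r.
Qed.

Lemma boundaryE p : boundary (mobius_pt p) = (`|p.2| = 1).
Proof.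
apply/propext; split=> [[q /= q1 /mobius_ptP[k ->]]|p1]; last by exists p.
by rewrite /= normrM norm_signz mul1r.
Qed.

Lemma within_clamp2 {T : topologicalType} (H : R * R -> T) :
  {within I01 `*` I01, continuous H} -> continuous (H \o clamp2).
Proof.
move=> /subspace_continuousP cH p.
have cp : (I01 `*` I01) (clamp2 p) by split; rewrite /= in_itv; exact: clamp01.
have := cH _ cp; apply: cvg_trans => W WH.
have := @continuous_clamp2 R p _ WH.
apply: (@filterS _ (nbhs p) (nbhs_filter p)) => q; apply.
by split; rewrite /= in_itv; exact: clamp01.
Qed.

Lemma within_clamp {T : topologicalType} (g : R -> T) :
  {within I01, continuous g} -> continuous (g \o @clamp R).
Proof.
move=> /subspace_continuousP cg x.
have cx : I01 (clamp x) by rewrite /= in_itv; exact: clamp01.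
have := cg _ cx; apply: cvg_trans => W WH.
have := @continuous_clamp R x _ WH.
apply: (@filterS _ (nbhs x) (nbhs_filter x)) => y; apply.
by rewrite /= in_itv; exact: clamp01.
Qed.

(** The invariant functions cos 2 pi x and sin 2 pi x determine [x] up to an
    integer, through an angle function; the sign of [y], which depends on the
    parity of that integer, is then recovered from y cos pi x and y sin pi x. *)
Lemma lift_square (H : R * R -> mobius R) p :
    {within I01 `*` I01, continuous H} -> H (0, 0) = mobius_pt p ->
  exists L : R * R -> R * R, [/\ continuous L, L (0, 0) = p &
    forall q, (I01 `*` I01) q -> H q = mobius_pt (L q)].
Proof.
move=> /within_clamp2 cH H0.
suff [L cL HL] : exists2 L : R * R -> R * R, continuous L &
    forall q, (I01 `*` I01) q -> H q = mobius_pt (L q).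
  have I00 : (I01 `*` I01) (0, 0) by split; rewrite /= in_itv/= lexx ler01.
  have /esym := HL _ I00; rewrite H0 => /mobius_ptP[k ->].
  exists (glide k \o L); split=> [|//|q Iq].
    by apply: cont_comp cL _; exact: continuous_glide.
  by rewrite /= mobius_pt_glide HL.
have id2 q : (I01 `*` I01) q -> clamp2 q = q.
  by case: q => x y [/=]; rewrite !in_itv/= /clamp2/= => ? ?; rewrite !clamp_id.
have c1 := @cont_fst R R fst erefl; have c2 := @cont_snd R R snd erefl.
have alg (b x c : R) : b != 0 -> (b * (2 * x) + b * (2 * c)) / (2 * b) = x + c.
  by move=> b0; field.
have two_pi x : pi * (2 * (x + 1%:~R)) = pi * (2 * x) + pi * 2%:~R :> R by ring.
have [F1 cF1 F1E] : exists2 F : mobius R -> R, continuous F &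
    forall p, F (mobius_pt p) = cos (pi * (2 * p.1)).
  apply: (@continuous_invariant (fun p => cos (pi * (2 * p.1)))); first by cont.
  by move=> q; rewrite /glide/= two_pi cosDpiz -exprnP sqrrN expr1n mul1r.
have [F2 cF2 F2E] : exists2 F : mobius R -> R, continuous F &
    forall p, F (mobius_pt p) = sin (pi * (2 * p.1)).
  apply: (@continuous_invariant (fun p => sin (pi * (2 * p.1)))); first by cont.
  by move=> q; rewrite /glide/= two_pi sinDpiz -exprnP sqrrN expr1n mul1r.
have [F3 cF3 F3E] : exists2 F : mobius R -> R, continuous F &
    forall p, F (mobius_pt p) = p.2 * cos (pi * p.1).
  apply: (@continuous_invariant (fun p => p.2 * cos (pi * p.1))); first by cont.
  by move=> q; rewrite /glide/= mulrDr cosDpiz mulrACA -expr2 signz_sqr mul1r.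
have [F4 cF4 F4E] : exists2 F : mobius R -> R, continuous F &
    forall p, F (mobius_pt p) = p.2 * sin (pi * p.1).
  apply: (@continuous_invariant (fun p => p.2 * sin (pi * p.1))); first by cont.
  by move=> q; rewrite /glide/= mulrDr sinDpiz mulrACA -expr2 signz_sqr mul1r.
have cFH F : continuous F -> continuous (fun q => F (H (clamp2 q)) : R).
  by move=> cF; exact: (@cont_comp _ _ _ (H \o clamp2) F).
have [a ca aE] := lift_circle (cFH _ cF1) (cFH _ cF2) ltac:(idtac;
  move=> q _; have [p' ->] := mobius_ptE (H (clamp2 q));
  rewrite F1E F2E; exact: cos2Dsin2).
have cF3H := cFH _ cF3; have cF4H := cFH _ cF4.
pose X q := a q / (2 * pi).
pose Y q := F3 (H (clamp2 q)) * cos (pi * X q) + F4 (H (clamp2 q)) * sin (pi * X q).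
have cX : continuous X by rewrite /X; cont.
have cY : continuous Y by rewrite /Y; cont.
exists (fun q => (X q, Y q)); first by cont.
move=> q Iq; have [ua va] := aE _ Iq.
have [[x y] HE] := mobius_ptE (H q).
move: ua va; rewrite id2// HE F1E F2E /= => ua va.
have [k kE] := same_angle ua va.
have XE : X q = x + k%:~R.
  by rewrite /X kE alg// gt_eqF// pi_gt0.
rewrite -(mobius_pt_glide k); congr mobius_pt; rewrite /glide/= -XE; congr pair.
rewrite /Y id2// HE F3E F4E /= XE mulrDr cosDpiz sinDpiz.
rewrite -[in LHS](mulr1 y) -(cos2Dsin2 (pi * x)); ring.
Qed.

(** The invariant by which arcs are told apart: the endpoints of a lift. *)
Definition joins (g : R -> mobius R) p q :=
  exists L : R -> R * R, [/\ continuous L, L 0 = p, L 1 = q &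
    forall s, I01 s -> g s = mobius_pt (L s)].

Lemma joins_exists g p : {within I01, continuous g} -> g 0 = mobius_pt p ->
  exists q, joins g p q.
Proof.
move=> /within_clamp cg g0.
have c00 : clamp (0 : R) = 0 by rewrite clamp_id// lexx ler01.
have cH : {within I01 `*` I01, continuous (fun q => g (clamp q.2))}.
  apply: continuous_subspaceT; apply: (@cont_comp _ _ _ snd (g \o @clamp R)) => //.
  exact: (@cont_snd R R snd erefl).
have [|L [cL L0 LE]] := @lift_square _ p cH; first by rewrite /= c00.
exists (L (0, 1)), (fun s => L (0, s)); split=> //.
  by apply: (@cont_comp _ _ _ (fun s : R => (0 : R, s)) L) => //; cont.
move=> s Is.
have s01 : 0 <= s <= 1 by move: Is; rewrite /= in_itv.
rewrite -LE/= ?clamp_id//.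
by split=> //=; rewrite in_itv/= lexx ler01.
Qed.

Lemma joins_glide g p q k : joins g p q -> joins g (glide k p) (glide k q).
Proof.
move=> [L [cL <- <- LE]]; exists (glide k \o L); split=> // [|s Is].
  by apply: cont_comp cL _; exact: continuous_glide.
by rewrite /= mobius_pt_glide LE.
Qed.

Lemma joins_reverse g p q : joins g p q -> joins (reverse g) q p.
Proof.
move=> [L [cL <- <- LE]]; exists (fun s => L (1 - s)).
split; rewrite ?subr0 ?subrr//.
  by apply: (@cont_comp _ _ _ (fun s : R => 1 - s) L) => //; cont.
move=> s; rewrite /reverse /= in_itv/= => s01.
by rewrite LE//= in_itv/=; lra.
Qed.

(** The abscissas of two lifts of a path differ by a continuous integer-valued
    function, which is constant. *)
Lemma joins_uniq g p q p' q' : joins g p q -> joins g p' q' ->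
  exists k, p' = glide k p /\ q' = glide k q.
Proof.
move=> [L [cL <- <- LE]] [L' [cL' <- <- L'E]].
have gk s : I01 s -> exists k, L' s = glide k (L s).
  by move=> Is; apply/mobius_ptP; rewrite -LE// L'E.
pose f s := (L' s).1 - (L s).1.
have I0 := @unit_itv0 R.
have I1 := @unit_itv1 R.
have [k kE] := gk 0 I0; exists k; split=> //.
have [l lE] := gk 1 I1; rewrite lE.
have := @int_valued_cst R f _ _ 1 ltac:(rewrite lexx ler01//).
rewrite /f kE lE /= !(addrC (L _).1) !addrK => h.
suff -> : l = k by [].
apply/eqP; rewrite -(eqr_int R); apply/eqP/h.
  apply: contD; [|apply: contN].
    by apply: cont_comp cL' _; exact: (@cont_fst R R fst erefl).
  by apply: cont_comp cL _; exact: (@cont_fst R R fst erefl).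
move=> s Is; have [|m mE] := gk s; first by rewrite /= in_itv.
by exists m; rewrite /f mE/= addrAC subrr add0r.
Qed.

Lemma glide_fixed k p : p = glide k p -> k = 0.
Proof.
move=> /(congr1 fst)/= /eqP; rewrite -subr_eq0 opprD addrA subrr add0r oppr_eq0.
by rewrite intr_eq0 => /eqP.
Qed.

Lemma joins_start_uniq g p q q' : joins g p q -> joins g p q' -> q' = q.
Proof. by move=> gq /(joins_uniq gq)[k [/glide_fixed -> ->]]; rewrite glide0. Qed.

Lemma joins_cst m p q : joins (fun=> m) p q -> q = p.
Proof.
move=> mpq; apply: (joins_start_uniq _ (mpq)); case: mpq => M [_ M0 _ ME].
exists (fun=> p); split=> [|//|//|s _]; first by cont.
by rewrite -M0 -ME//= in_itv/= lexx ler01.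
Qed.

(** In a lift of the homotopy, the two sides of the square over the fixed
    endpoints are lifts of constant paths, hence constant. *)
Lemma homotopic_joins g h p q : homotopic g h -> joins g p q -> joins h p q.
Proof.
move=> [H [cH _ Hgh Hend]] gpq.
have I0 := @unit_itv0 R.
have I1 := @unit_itv1 R.
have g0 : g 0 = mobius_pt p by case: (gpq) => L [_ <- _]; apply.
have [|L [cL L0 LE]] := @lift_square H p cH.
  by rewrite (proj1 (Hgh 0 I0)).
have line (f : R -> R * R) : continuous f -> continuous (fun s => L (f s)).
  by move=> cf; exact: (@cont_comp _ _ _ f L).
have hline x : I01 x -> joins (fun s => H (x, s)) (L (x, 0)) (L (x, 1)).
  move=> Ix; exists (fun s => L (x, s)); split=> [|//|//|s Is]; last by rewrite -LE.
  by apply: (line (fun s => (x, s))); cont.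
have vline y : I01 y -> joins (fun r => H (r, y)) (L (0, y)) (L (1, y)).
  move=> Iy; exists (fun r => L (r, y)); split=> [|//|//|r Ir]; last by rewrite -LE.
  by apply: (line (fun r => (r, y))); cont.
have eqj g1 g2 z w : (forall s, I01 s -> g1 s = g2 s) -> joins g1 z w -> joins g2 z w.
  by move=> g12 [M [? ? ? ME]]; exists M; split=> // s Is; rewrite -g12// ME.
have L01 : L (0, 1) = q.
  apply: (joins_start_uniq gpq); rewrite -L0.
  by apply: eqj (hline 0 I0) => s /Hgh[].
have L10 : L (1, 0) = p.
  rewrite -[RHS]L0; apply: (@joins_cst (g 0)); apply: eqj (vline 0 I0) => r Ir.
  by have [] := Hend r Ir.
have L11 : L (1, 1) = q.
  rewrite -[RHS]L01; apply: (@joins_cst (g 1)); apply: eqj (vline 1 I1) => r Ir.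
  by have [] := Hend r Ir.
rewrite -[X in joins _ X _]L10 -[X in joins _ _ X]L11.
by apply: eqj (hline 1 I1) => s /Hgh[].
Qed.

(** The strip |y| <= 1 of the plane is convex: the segments between two lifts
    with the same endpoints define a homotopy. *)
Lemma joins_homotopic g h p q : joins g p q -> joins h p q ->
  g @` I01 `<=` @strip R -> h @` I01 `<=` @strip R -> homotopic g h.
Proof.
move=> [L [cL L0 L1 LE]] [M [cM M0 M1 ME]] gS hS.
pose K (z : R * R) : R * R :=
  ((1 - z.1) * (L z.2).1 + z.1 * (M z.2).1, (1 - z.1) * (L z.2).2 + z.1 * (M z.2).2).
have c1 := @cont_fst R R fst erefl; have c2 := @cont_snd R R snd erefl.
have cK : continuous K.
  have cL1 := cont_comp (cont_comp c2 cL) c1; have cL2 := cont_comp (cont_comp c2 cL) c2.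
  have cM1 := cont_comp (cont_comp c2 cM) c1; have cM2 := cont_comp (cont_comp c2 cM) c2.
  by rewrite /K; cont.
have I0 := @unit_itv0 R.
have I1 := @unit_itv1 R.
exists (fun z => mobius_pt (K z)); split.
- apply: continuous_subspaceT; apply: (cont_comp cK); exact: continuous_mobius_pt.
- move=> _ [[r s] [/= Ir Is] <-]; rewrite stripE /K/=.
  have Ls : strip (g s) by apply: gS; exists s.
  have Ms : strip (h s) by apply: hS; exists s.
  move: Ls Ms; rewrite LE// ME// !stripE !ler_norml; move: Ir; rewrite in_itv/=.
  by move: (L s).2 (M s).2 => x y; nra.
- move=> s Is; rewrite LE// ME// /K/= !subr0 !subrr !mul1r !mul0r !addr0 !add0r.
  by case: (L s) (M s) => ? ? [].
- move=> r Ir; rewrite !LE// /K/= L0 M0 L1 M1 -!mulrDl !subrK !mul1r.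
  by case: p q {L0 L1 M0 M1} => ? ? [].
Qed.
End Covering.

(** * Linked paths in a strip meet *)

Section Crossing.
Context {R : realType}.
Implicit Types (x : R) (k l : int) (L M : R -> R * R).
Local Notation I01 := (`[0, 1]%classic : set R).

(** The angles of the vectors of the closed upper, resp. lower, half plane form
    one such interval for each [k].  A continuous angle with values in one half
    plane stays in one interval. *)
Definition upper_turn k x := pi * (2 * k%:~R) <= x <= pi * (2 * k%:~R + 1).
Definition lower_turn k x := pi * (2 * k%:~R - 1) <= x <= pi * (2 * k%:~R).

Lemma upper_turn_inj k l x : upper_turn k x -> upper_turn l x -> k = l.
Proof.
move=> /andP[k1 k2] /andP[l1 l2]; have p0 := pi_gt0 R.
have : pi * (2 * k%:~R) <= pi * (2 * l%:~R + 1) :> R := le_trans k1 l2.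
have : pi * (2 * l%:~R) <= pi * (2 * k%:~R + 1) :> R := le_trans l1 k2.
rewrite !ler_pM2l// -!(intrM _ 2) -!(intrD _ _ 1) !ler_int; lia.
Qed.

Lemma lower_turn_inj k l x : lower_turn k x -> lower_turn l x -> k = l.
Proof.
move=> /andP[k1 k2] /andP[l1 l2]; have p0 := pi_gt0 R.
have : pi * (2 * k%:~R - 1) <= pi * (2 * l%:~R) :> R := le_trans k1 l2.
have : pi * (2 * l%:~R - 1) <= pi * (2 * k%:~R) :> R := le_trans l1 k2.
rewrite !ler_pM2l// -!(intrM _ 2) -!(intrB _ _ 1) !ler_int; lia.
Qed.

(** Consecutive upper and lower intervals share one endpoint, a multiple of pi
    whose parity says on which side the vector points. *)
Lemma cos_turn_meet k l x : upper_turn k x -> lower_turn l x ->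
  cos x = (-1) ^ (l - k).
Proof.
move=> /andP[k1 k2] /andP[l1 l2]; have p0 := pi_gt0 R.
have kl : pi * (2 * k%:~R) <= pi * (2 * l%:~R) :> R := le_trans k1 l2.
have lk : pi * (2 * l%:~R - 1) <= pi * (2 * k%:~R + 1) :> R := le_trans l1 k2.
have cos2 (m : int) : (-1) ^ (m + m) = 1 :> R.
  by rewrite expfzDr ?oppr_eq0 ?oner_eq0// -expr2 signz_sqr.
have cosE (m : int) : x = pi * m%:~R -> cos x = (-1) ^ m.
  by move=> ->; rewrite -[pi * _]add0r cosDpiz cos0 mulr1.
have [lE|lE] : l = k \/ l = k + 1.
  move: kl lk; rewrite !ler_pM2l// -!(intrM _ 2) -!(intrD _ _ 1) -!(intrB _ _ 1).
  by rewrite !ler_int; lia.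
  subst l; rewrite subrr expr0z -(cos2 k); apply: cosE; rewrite intrD; lra.
subst l; rewrite (cosE (k + k + 1)); last by move: l1 l2; rewrite !intrD; lra.
by rewrite expfzDr ?oppr_eq0 ?oner_eq0// cos2 addrAC subrr add0r mul1r.
Qed.

Lemma upper_turnP (f : R -> R) : continuous f ->
  (forall s, I01 s -> 0 <= sin (f s)) ->
  exists k, forall s, I01 s -> upper_turn k (f s).
Proof.
move=> cf f0; have p0 := pi_gt0 R.
have I0 := @unit_itv0 R.
pose k := Num.floor (f 0 / (2 * pi)).
have sinE y : sin y = sin (y - pi * (2 * k%:~R)).
  rewrite -[y in LHS](subrK (pi * (2 * k%:~R))).
  rewrite (_ : 2 * k%:~R = (k + k)%:~R); last by rewrite intrD; ring.
  by rewrite sinDpiz expfzDr ?oppr_eq0 ?oner_eq0// -expr2 signz_sqr mul1r.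
have sin_above y : pi * (2 * k%:~R + 1) < y < pi * (2 * k%:~R + 2) -> sin y < 0.
  move=> hy; rewrite sinE -[y - _](subrK pi) sinDpi oppr_lt0; apply: sin_gt0_pi; lra.
have sin_below y : pi * (2 * k%:~R - 1) < y < pi * (2 * k%:~R) -> sin y < 0.
  move=> hy; rewrite sinE -oppr_gt0 -sinN; apply: sin_gt0_pi; lra.
have kf0 : pi * (2 * k%:~R) <= f 0.
  have := ge_floor (f 0 / (2 * pi)); rewrite -/k ler_pdivlMr; last lra.
  by lra.
have f0k : f 0 < pi * (2 * k%:~R + 2).
  have := lt_succ_floor (f 0 / (2 * pi)); rewrite -/k ltr_pdivrMr; last lra.
  by rewrite intrD; lra.
have f0k' : f 0 <= pi * (2 * k%:~R + 1).
  rewrite leNgt; apply/negP => h.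
  by have := f0 _ I0; rewrite leNgt sin_above// h.
have reach s v : I01 s -> Num.min (f 0) (f s) <= v <= Num.max (f 0) (f s) -> 0 <= sin v.
  rewrite /= in_itv/= => /andP[s0 s1] hv.
  have [c] := IVT s0 (continuous_subspaceT cf) hv.
  rewrite in_itv/= => /andP[c0 cs] <-; apply: f0; rewrite /= in_itv/= c0.
  exact: le_trans cs s1.
exists k => s Is; apply/andP; split; rewrite leNgt; apply/negP => fs.
  pose v := Num.max (f s) (pi * (2 * k%:~R - 2^-1)).
  have : 0 <= sin v.
    apply: (reach s) => //; apply/andP; split.
      by rewrite ge_min /v; apply/orP; right; rewrite le_max lexx.
    by rewrite ge_max; apply/andP; split; rewrite le_max; apply/orP; [right|left]; lra.
  rewrite leNgt sin_below//.
  by rewrite lt_max gt_max; apply/andP; split; [apply/orP; right|apply/andP; split]; lra.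
pose v := Num.min (f s) (pi * (2 * k%:~R + 1 + 2^-1)).
have : 0 <= sin v.
  apply: (reach s) => //; apply/andP; split.
    by rewrite le_min; apply/andP; split; rewrite ge_min; apply/orP; [right|left]; lra.
  by rewrite le_max /v; apply/orP; right; rewrite ge_min lexx.
rewrite leNgt sin_above//.
by rewrite gt_min lt_min; apply/andP; split; [apply/andP; split|apply/orP; right]; lra.
Qed.

Lemma lower_turnP (f : R -> R) : continuous f ->
  (forall s, I01 s -> sin (f s) <= 0) ->
  exists k, forall s, I01 s -> lower_turn k (f s).
Proof.
move=> cf f0; have [||k kE] := @upper_turnP (fun s => f s + pi).
- by cont.
- by move=> s /f0; rewrite sinDpi oppr_ge0.
- by exists k => s /kE; rewrite /upper_turn /lower_turn; lra.
Qed.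

(** Paths that do not meet have a nonvanishing difference, defined on the
    square. *)
Lemma square_angle L M : continuous L -> continuous M ->
    (forall s t, I01 s -> I01 t -> L s <> M t) ->
  exists2 a : R * R -> R, continuous a &
    forall s t, I01 s -> I01 t -> exists2 r, 0 < r &
      (L s).1 - (M t).1 = r * cos (a (s, t)) /\ (L s).2 - (M t).2 = r * sin (a (s, t)).
Proof.
move=> cL cM LM.
have c1 := @cont_fst R R fst erefl; have c2 := @cont_snd R R snd erefl.
have cc := @continuous_clamp R.
have cL' : continuous (fun z : R * R => L (clamp z.1)) := cont_comp (cont_comp c1 cc) cL.
have cM' : continuous (fun z : R * R => M (clamp z.2)) := cont_comp (cont_comp c2 cc) cM.
pose dx (z : R * R) := (L (clamp z.1)).1 - (M (clamp z.2)).1.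
pose dy (z : R * R) := (L (clamp z.1)).2 - (M (clamp z.2)).2.
have cdx : continuous dx.
  by have := cont_comp cL' c1; have := cont_comp cM' c1; rewrite /dx => ? ?; cont.
have cdy : continuous dy.
  by have := cont_comp cL' c2; have := cont_comp cM' c2; rewrite /dy => ? ?; cont.
have d0 z : 0 < dx z ^+ 2 + dy z ^+ 2.
  rewrite lt0r addr_ge0 ?sqr_ge0// andbT paddr_eq0 ?sqr_ge0// !sqrf_eq0 !subr_eq0.
  apply/negP => /andP[/eqP h1 /eqP h2].
  apply: (LM (clamp z.1) (clamp z.2)); rewrite /= ?in_itv; try exact: clamp01.
  by case: (L _) (M _) h1 h2 => ? ? [? ?] /= -> ->.
pose n z := Num.sqrt (dx z ^+ 2 + dy z ^+ 2).
have n0 z : 0 < n z by rewrite sqrtr_gt0.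
have cn : continuous n.
  apply: (@cont_comp _ _ _ (fun z => dx z ^+ 2 + dy z ^+ 2) Num.sqrt); first by cont.
  exact: sqrt_continuous.
have cn' : continuous (fun z => (n z)^-1).
  by apply: contV => // z; rewrite gt_eqF.
have cu : continuous (fun z => dx z * (n z)^-1) by cont.
have cv : continuous (fun z => dy z * (n z)^-1) by cont.
have [|a ca aE] := lift_circle cu cv.
  move=> z _; rewrite !exprMn -mulrDl exprVn sqr_sqrtr ?divff// ?gt_eqF//.
  exact: ltW.
exists a => // s t Is It; exists (n (s, t)) => //.
have [-> ->] := aE (s, t) (conj Is It).
rewrite !(mulrC (n _)) !divfK ?gt_eqF// /dx /dy/=.
by move: Is It; rewrite /= !in_itv/= => Is It; rewrite !clamp_id.
Qed.

Section Linked.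
Variables L M : R -> R * R.
Hypotheses (cL : continuous L) (cM : continuous M).
Hypothesis L1 : forall s, I01 s -> `|(L s).2| <= 1.
Hypothesis M1 : forall s, I01 s -> `|(M s).2| <= 1.
Hypothesis LM : forall s t, I01 s -> I01 t -> L s <> M t.

Let I0 := @unit_itv0 R.
Let I1 := @unit_itv1 R.

(** The difference of the paths is in the upper half plane on the sides s = 0
    and t = 1 of the square, and in the lower one on the two other sides.  It
    points to the left at the corner (0, 0) and to the right at (1, 1): going
    from one to the other, the angle decreases by pi along the first two sides
    and increases by pi along the others. *)
Lemma crossing_lines a b a' b' : L 0 = (a, 1) -> L 1 = (b, -1) ->
  M 0 = (a', 1) -> M 1 = (b', -1) -> a < a' -> b' < b -> False.
Proof.
move=> La Lb Ma Mb aa bb.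
have [A cA AE] := square_angle cL cM LM.
have line (f : R -> R * R) : continuous f -> continuous (fun s => A (f s)).
  by move=> cf; exact: (@cont_comp _ _ _ f A).
have [|k0 k0E] := @upper_turnP (fun t => A (0, t)) (line (fun t => (0, t)) ltac:(cont)).
  move=> t It; have [r r0 [_]] := AE 0 t I0 It.
  by have := M1 It; rewrite ler_norml La/= => ? ?; nra.
have [|k1 k1E] := @upper_turnP (fun s => A (s, 1)) (line (fun s => (s, 1)) ltac:(cont)).
  move=> s Is; have [r r0 [_]] := AE s 1 Is I1.
  by have := L1 Is; rewrite ler_norml Mb/= => ? ?; nra.
have [|l0 l0E] := @lower_turnP (fun s => A (s, 0)) (line (fun s => (s, 0)) ltac:(cont)).
  move=> s Is; have [r r0 [_]] := AE s 0 Is I0.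
  by have := L1 Is; rewrite ler_norml Ma/= => ? ?; nra.
have [|l1 l1E] := @lower_turnP (fun t => A (1, t)) (line (fun t => (1, t)) ltac:(cont)).
  move=> t It; have [r r0 [_]] := AE 1 t I1 It.
  by have := M1 It; rewrite ler_norml Lb/= => ? ?; nra.
have k01 := upper_turn_inj (k0E 1 I1) (k1E 0 I0).
have l01 := lower_turn_inj (l0E 1 I1) (l1E 0 I0).
have [r r0 [+ _]] := AE 0 0 I0 I0; rewrite La Ma (cos_turn_meet (k0E 0 I0) (l0E 0 I0))/=.
have [r' r'0 [+ _]] := AE 1 1 I1 I1; rewrite Lb Mb (cos_turn_meet (k1E 1 I1) (l1E 1 I1))/=.
by rewrite k01 l01; case: (@signzP R (l1 - k1)) => ->; nra.
Qed.

(** The difference of the paths is in the upper half plane on all sides but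
    t = 0, at the ends of which it points to the left and to the right: again
    the angle changes by pi in opposite directions along the two ways. *)
Lemma crossing_cap a b a' b' : L 0 = (a, 1) -> L 1 = (b, 1) ->
  M 0 = (a', 1) -> M 1 = (b', -1) -> a < a' < b -> False.
Proof.
move=> La Lb Ma Mb /andP[aa ab].
have [A cA AE] := square_angle cL cM LM.
have line (f : R -> R * R) : continuous f -> continuous (fun s => A (f s)).
  by move=> cf; exact: (@cont_comp _ _ _ f A).
have [|k0 k0E] := @upper_turnP (fun t => A (0, t)) (line (fun t => (0, t)) ltac:(cont)).
  move=> t It; have [r r0 [_]] := AE 0 t I0 It.
  by have := M1 It; rewrite ler_norml La/= => ? ?; nra.
have [|k1 k1E] := @upper_turnP (fun s => A (s, 1)) (line (fun s => (s, 1)) ltac:(cont)).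
  move=> s Is; have [r r0 [_]] := AE s 1 Is I1.
  by have := L1 Is; rewrite ler_norml Mb/= => ? ?; nra.
have [|k2 k2E] := @upper_turnP (fun t => A (1, t)) (line (fun t => (1, t)) ltac:(cont)).
  move=> t It; have [r r0 [_]] := AE 1 t I1 It.
  by have := M1 It; rewrite ler_norml Lb/= => ? ?; nra.
have [|l l0E] := @lower_turnP (fun s => A (s, 0)) (line (fun s => (s, 0)) ltac:(cont)).
  move=> s Is; have [r r0 [_]] := AE s 0 Is I0.
  by have := L1 Is; rewrite ler_norml Ma/= => ? ?; nra.
have k01 := upper_turn_inj (k0E 1 I1) (k1E 0 I0).
have k12 := upper_turn_inj (k1E 1 I1) (k2E 1 I1).
have [r r0 [+ _]] := AE 0 0 I0 I0; rewrite La Ma (cos_turn_meet (k0E 0 I0) (l0E 0 I0))/=.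
have [r' r'0 [+ _]] := AE 1 0 I1 I0; rewrite Lb Ma (cos_turn_meet (k2E 0 I0) (l0E 1 I1))/=.
by rewrite k01 k12; case: (@signzP R (l - k2)) => ->; nra.
Qed.
End Linked.
End Crossing.

(** * Arc classes and the endpoints of lifts *)

Section ArcClasses.
Context {R : realType} {n : nat} (t : 'I_n -> R).
Implicit Types (p q : R * R) (k m : int) (a b c x : R) (g h : R -> mobius R).
Local Notation I01 := (`[0, 1]%classic : set R).

Let I0 := @unit_itv0 R.
Let I1 := @unit_itv1 R.

Lemma signzE k : exists m, (k = 2 * m /\ (-1) ^ k = 1 :> R) \/
  (k = 2 * m + 1 /\ (-1) ^ k = -1 :> R).
Proof.
have even m : (-1) ^ (2 * m) = 1 :> R.
  by rewrite (_ : 2 * m = m + m) ?expfzDr ?oppr_eq0 ?oner_eq0// -?expr2 ?signz_sqr//; lia.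
exists (k %/ 2)%Z; have [kE|kE] : k = 2 * (k %/ 2)%Z \/ k = 2 * (k %/ 2)%Z + 1 by lia.
  by left; split=> //; rewrite kE even.
by right; split=> //; rewrite kE expfzDr ?oppr_eq0 ?oner_eq0// even mul1r expr1z.
Qed.

Lemma mobius_pt_eqP p q : mobius_pt p = mobius_pt q ->
  exists m, (q.1 = p.1 + 2 * m%:~R /\ q.2 = p.2) \/
            (q.1 = p.1 + 2 * m%:~R + 1 /\ q.2 = - p.2).
Proof.
move=> /mobius_ptP[k ->]; have [m [[kE sk]|[kE sk]]] := signzE k; exists m.
  by left; rewrite /= sk mul1r kE intrM.
by right; rewrite /= sk mulN1r kE intrD intrM addrA.
Qed.

Lemma int_trichotomy m : [\/ m = 0, 1 <= m%:~R :> R | m%:~R <= -1 :> R].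
Proof.
have [->|] := eqVneq m 0; [by constructor 1|move=> m0].
have [m1|m1] : 1 <= m \/ m <= -1 by lia.
  by constructor 2; rewrite (ler_int R 1).
by constructor 3; rewrite (ler_int R _ (-1)).
Qed.

Lemma markedD x m : marked t x -> marked t (x + 2 * m%:~R).
Proof. by move=> [i [k ->]]; exists i, (k + m); rewrite intrD; ring. Qed.

Definition arcs_joining p q : set (R -> mobius R) :=
  [set g | simple_arc t g /\ (joins g p q \/ joins g q p)].

(** With [a <= c <= a + 2], the crossing arcs between the vertices [a] and [c]:
    their lifts run from the line y = 1 to the line y = -1, where the points
    over the vertex [c] are the (c - 1 + 2 k, -1). *)
Definition cross_class a c := arcs_joining (a, 1) (c - 1, -1).
(** The arcs parallel to the boundary between [a] and [b]. *)
Definition cap_class a b := arcs_joining (a, 1) (b, 1).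

Lemma arcs_joiningC p q : arcs_joining p q = arcs_joining q p.
Proof.
by apply/seteqP; split=> g [sg [j|j]]; split=> //; [right|left|right|left].
Qed.

Lemma arcs_joining_glide k p q :
  arcs_joining (glide k p) (glide k q) = arcs_joining p q.
Proof.
apply/seteqP; split=> g [sg [] j]; split=> //.
- by left; have := @joins_glide _ _ _ _ (- k) j; rewrite !glideK.
- by right; have := @joins_glide _ _ _ _ (- k) j; rewrite !glideK.
- by left; apply: joins_glide.
- by right; apply: joins_glide.
Qed.

Lemma glide_even m p : glide (2 * m) p = (p.1 + 2 * m%:~R, p.2).
Proof.
rewrite /glide intrM (_ : 2 * m = m + m); last by lia.
by rewrite expfzDr ?oppr_eq0 ?oner_eq0// -expr2 signz_sqr mul1r.
Qed.

Lemma cross_classD m a c : cross_class (a + 2 * m%:~R) (c + 2 * m%:~R) = cross_class a c.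
Proof.
rewrite /cross_class -[RHS](arcs_joining_glide (2 * m)) !glide_even/=.
by rewrite addrAC.
Qed.

Lemma cap_classD m a b : cap_class (a + 2 * m%:~R) (b + 2 * m%:~R) = cap_class a b.
Proof. by rewrite /cap_class -[RHS](arcs_joining_glide (2 * m)) !glide_even. Qed.

(** The glide reflection exchanges the two boundary lines of the strip, so a lift
    of the reversed arc also descends from the line y = 1. *)
Lemma cross_classC a c : cross_class c (a + 2) = cross_class a c.
Proof.
rewrite /cross_class arcs_joiningC -[RHS](arcs_joining_glide 1) /glide/= expr1z.
congr (arcs_joining (_, _) (_, _)); ring.
Qed.

Lemma reverseK g : reverse (reverse g) = g.
Proof. by apply/funext => s; rewrite /reverse subKr. Qed.

Lemma reverse_strip g : g @` I01 `<=` @strip R -> reverse g @` I01 `<=` @strip R.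
Proof.
move=> gS _ [s /= Is <-]; apply: gS; exists (1 - s) => //.
by move: Is; rewrite /= !in_itv/=; lra.
Qed.

Lemma arc_class_joining g p q : simple_arc t g -> joins g p q ->
  arc_class t g = arcs_joining p q.
Proof.
move=> sg gpq; have [[_ gS] _ _ _] := sg.
apply/seteqP; split=> h [sh hg]; split=> //.
  case: hg => /homotopic_joins/(_ gpq); first by left.
  by move/joins_reverse; rewrite reverseK; right.
have [[_ hS] _ _ _] := sh; case: hg => [j|/joins_reverse j].
  by left; apply: joins_homotopic gpq j _ _.
by right; apply: joins_homotopic gpq j _ _ => //; exact: reverse_strip.
Qed.

Lemma joins_edge (e : R -> mobius R) a b :
  (forall s, I01 s -> e s = boundary_pt (a + s * (b - a))) -> joins e (a, 1) (b, 1).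
Proof.
move=> eE; exists (fun s => (a + s * (b - a), 1)); split=> //.
- by cont.
- by rewrite mul0r addr0.
- by rewrite mul1r addrC subrK.
Qed.

(** A lift starting at (a, 1) may end over any vertex, on either line.  Ending
    at (a, 1), or at a neighbouring vertex of the same line, makes the arc trivial,
    by convexity of the strip. *)
Lemma arc_classes_joining A : arc_classes t A ->
  (exists a b x,
     [/\ marked t a, marked t b, marked t x, a < x < b & A = cap_class a b]) \/
  (exists a c, [/\ marked t a, marked t c & A = cross_class a c]).
Proof.
move=> [g [sg ntg] <-]; have [[cg gS] [[a ma g0] [c0 mc0 g1]] _ _] := sg.
have [q gq] := joins_exists cg (esym g0).
have qE : mobius_pt (c0, 1) = mobius_pt q.
  by case: gq => L [_ _ <- LE]; rewrite -LE// -g1.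
have [m [[q1 q2]|[q1 q2]]] := mobius_pt_eqP qE; last first.
  right; exists a, (c0 + 2 * m%:~R + 2); split=> //.
    rewrite (_ : _ + 2 = c0 + 2 * (m + 1)%:~R); first exact: markedD.
    by rewrite intrD; ring.
  rewrite (arc_class_joining sg gq) /cross_class; congr arcs_joining.
  by case: (q) q1 q2 => ? ? /= -> ->; congr pair; ring.
left; pose b := c0 + 2 * m%:~R.
have mb : marked t b by exact: markedD.
have {}gq : joins g (a, 1) (b, 1) by case: (q) q1 q2 gq => ? ? /= -> ->.
have ab : a <> b.
  move=> ab; apply: ntg; left; exists (boundary_pt a); first by exists a.
  apply: (joins_homotopic gq _ gS).
    by rewrite -ab; exists (fun=> (a, 1)); split=> //; cont.
  by move=> _ [s _ <-]; rewrite stripE normr1.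
have edge_strip (e : R -> mobius R) x y :
    (forall s, I01 s -> e s = boundary_pt (x + s * (y - x))) ->
    e @` I01 `<=` @strip R.
  by move=> eE _ [s Is <-]; rewrite eE// stripE normr1.
have between x y : marked t x -> marked t y -> x < y ->
    joins g (x, 1) (y, 1) \/ joins g (y, 1) (x, 1) -> exists2 z, marked t z & x < z < y.
  move=> mx my xy gxy; apply: contrapT => nz; apply: ntg; right.
  pose e s : mobius R := boundary_pt (x + s * (y - x)).
  have je : joins e (x, 1) (y, 1) by exact: joins_edge.
  exists e; first by exists x, y; split=> // z xzy mz; apply: nz; exists z.
  case: gxy => gxy; [left|right].
    by apply: joins_homotopic gxy je gS _; exact: (edge_strip e x y).
  apply: joins_homotopic gxy (joins_reverse je) gS _.
  by apply: reverse_strip; exact: (edge_strip e x y).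
have [lt_ab|lt_ba|//] := ltgtP a b.
  have [|z mz azb] := between a b ma mb lt_ab; first by left.
  by exists a, b, z; split=> //; rewrite (arc_class_joining sg gq).
have [|z mz azb] := between b a mb ma lt_ba; first by right.
by exists b, a, z; split=> //; rewrite (arc_class_joining sg gq) /cap_class arcs_joiningC.
Qed.

(** Whether a lift joins a boundary line to itself or to the other one. *)
Lemma joins_parity g p q p' q' : joins g p q -> joins g p' q' ->
  p'.2 * q'.2 = p.2 * q.2.
Proof.
move=> j /(joins_uniq j)[k [-> ->]].
by rewrite /glide/= mulrACA -expr2 signz_sqr mul1r.
Qed.

Lemma cap_cross_disjoint a b a' c' g : cap_class a b g -> cross_class a' c' g -> False.
Proof.
by move=> [_ [] j] [_ [] /(joins_parity j)]/=; lra.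
Qed.

Lemma trivial_arc_joins g p q : trivial_arc t g -> joins g p q ->
  q = p \/ exists a b k, [/\ a < b, (forall x, a < x < b -> ~ marked t x) &
    (glide k p = (a, 1) /\ glide k q = (b, 1)) \/
    (glide k p = (b, 1) /\ glide k q = (a, 1))].
Proof.
move=> [[v _ gv]|[e [a [b [_ _ ab nab eE]]] ge]] gpq.
  by left; apply: (@joins_cst R v); exact: homotopic_joins gv gpq.
right; exists a, b; have je := joins_edge eE.
case: ge => /homotopic_joins/(_ gpq) j.
  by have [k [-> ->]] := joins_uniq j je; exists k; split=> //; left.
have [k [-> ->]] := joins_uniq j (joins_reverse je).
by exists k; split=> //; right.
Qed.

(** The segment from (a, 1) to (c - 1, -1). *)
Definition cross_arc a c s : mobius R := mobius_pt (a + s * (c - 1 - a), 1 - 2 * s).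

(** A parabola; owing to the factor [b - a] its slope is at most 1 in absolute
    value, whereas the crossing loops have slopes 2 and -2. *)
Definition cap_arc a b s : mobius R :=
  mobius_pt (a + s * (b - a), 1 - s * (1 - s) * (b - a)).

Lemma joins_cross_arc a c : joins (cross_arc a c) (a, 1) (c - 1, -1).
Proof.
exists (fun s => (a + s * (c - 1 - a), 1 - 2 * s)); split=> //.
- by cont.
- by rewrite mul0r mulr0 addr0 subr0.
- by congr pair; ring.
Qed.

Lemma joins_cap_arc a b : joins (cap_arc a b) (a, 1) (b, 1).
Proof.
exists (fun s => (a + s * (b - a), 1 - s * (1 - s) * (b - a))); split=> //.
- by cont.
- by congr pair; ring.
- by congr pair; ring.
Qed.

Lemma simple_arc_intro g p q : joins g p q -> crown_vertex t (mobius_pt p) ->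
  crown_vertex t (mobius_pt q) -> g @` I01 `<=` @strip R ->
  (forall r s, I01 r -> I01 s -> r < s -> g r = g s -> r = 0 /\ s = 1) ->
  (forall s : R, 0 < s < 1 -> ~ @boundary R (g s)) -> simple_arc t g.
Proof.
move=> [L [cL L0 L1 LE]] vp vq gS ginj gbd; 
have g0 : crown_vertex t (g 0) by rewrite LE// L0.
have g1 : crown_vertex t (g 1) by rewrite LE// L1.
split=> //; split=> //.
have cg : continuous (fun s => mobius_pt (L s)) := cont_comp cL (@continuous_mobius_pt R).
apply: (subspace_eq_continuous _ (continuous_subspaceT cg)).
by move=> s /set_mem Is; exact: (esym (LE s Is)).
Qed.

Lemma simple_cross_arc a c : marked t a -> marked t c -> a <= c <= a + 2 ->
  simple_arc t (cross_arc a c).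
Proof.
move=> ma mc ac; apply: (simple_arc_intro (joins_cross_arc a c)).
- by exists a.
- exists c => //; apply/esym/mobius_ptP; exists 1.
  by rewrite /glide/= expr1z mulrNN mulr1 subrK.
- move=> _ [s /= + <-]; rewrite in_itv/= stripE /= ler_norml => ?; lra.
- move=> r s; rewrite /= !in_itv/= => Ir Is rs /mobius_pt_eqP[m [[/= e1 e2]|[/= e1 e2]]].
    lra.
  have sE : s = 1 - r by lra.
  have [m0|m1|m1] := int_trichotomy m.
  - subst m; nra.
  - nra.
  - nra.
- move=> s s01; rewrite boundaryE/= => /eqP; rewrite eqr_norml; lra.
Qed.
End ArcClasses.

(** * Disjointness of arc classes *)

Section ArcDisjointness.
Context {R : realType} {n : nat} (t : 'I_n -> R).
Implicit Types (p q : R * R) (k m : int) (a b c x : R) (g h : R -> mobius R).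
Local Notation I01 := (`[0, 1]%classic : set R).

Lemma simple_cap_arc a b : marked t a -> marked t b -> a < b < a + 2 ->
  simple_arc t (cap_arc a b).
Proof.
move=> ma mb ab; have y_pos s : 0 <= s <= 1 -> 0 < 1 - s * (1 - s) * (b - a).
  move=> s01; have s4 : s * (1 - s) <= 4^-1 by have := sqr_ge0 (s - 2^-1); lra.
  by have := @ler_wpM2r R (b - a) ltac:(lra) _ _ s4; lra.
apply: (simple_arc_intro (joins_cap_arc a b)).
- by exists a.
- by exists b.
- move=> _ [s /= + <-]; rewrite in_itv/= stripE /= ler_norml => Is.
  have := y_pos s Is; have : 0 <= s * (1 - s) * (b - a) by rewrite !mulr_ge0//; lra.
  by lra.
- move=> r s; rewrite /= !in_itv/= => Ir Is rs /mobius_pt_eqP[m [[/= e1 e2]|[/= e1 e2]]].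
    have sr0 : 0 < (s - r) * (b - a) by apply: mulr_gt0; lra.
    have sr2 : (s - r) * (b - a) <= b - a by apply: ler_piMl; lra.
    by have [m0|m1|m1] := @int_trichotomy R m; [subst m; lra|lra|lra].
  by have := y_pos r Ir; have := y_pos s Is; lra.
- move=> s s01; rewrite boundaryE/= => /eqP; rewrite eqr_norml.
  have := y_pos s ltac:(lra); have : 0 < s * (1 - s) * (b - a) by rewrite !mulr_gt0//; lra.
  by lra.
Qed.

Lemma cross_arc_class a c : marked t a -> marked t c -> a <= c <= a + 2 ->
  cross_class t a c (cross_arc a c).
Proof.
move=> ma mc ac; split; first exact: simple_cross_arc.
by left; exact: joins_cross_arc.
Qed.

Lemma cap_arc_class a b : marked t a -> marked t b -> a < b < a + 2 ->
  cap_class t a b (cap_arc a b).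
Proof.
move=> ma mb ab; split; first exact: simple_cap_arc.
by left; exact: joins_cap_arc.
Qed.

Lemma cross_class_arc a c : marked t a -> marked t c -> a <= c <= a + 2 ->
  arc_classes t (cross_class t a c).
Proof.
move=> ma mc ac; have sg := simple_cross_arc ma mc ac; have jg := joins_cross_arc a c.
exists (cross_arc a c); last exact: arc_class_joining.
split=> // /trivial_arc_joins/(_ jg)[[?]|]; first by lra.
move=> [x [y [k [_ _ h]]]].
have [m [[_ sk]|[_ sk]]] := @signzE R k; rewrite /glide sk /= in h.
  by case: h => -[[? ?] [? ?]]; lra.
by case: h => -[[? ?] [? ?]]; lra.
Qed.

Lemma cap_class_arc a b x : marked t a -> marked t b -> marked t x ->
  a < x < b -> b < a + 2 -> arc_classes t (cap_class t a b).
Proof.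
move=> ma mb mx axb ba.
have ab : a < b < a + 2 by lra.
have sg := simple_cap_arc ma mb ab; have jg := joins_cap_arc a b.
exists (cap_arc a b); last exact: arc_class_joining.
split=> // /trivial_arc_joins/(_ jg)[[?]|]; first by lra.
move=> [y [z [k [yz nyz h]]]].
have [m [[kE sk]|[_ sk]]] := @signzE R k; rewrite /glide sk /= in h; last first.
  by case: h => -[[? ?] [? ?]]; lra.
case: h => -[[hy _] [hz _]]; last by lra.
apply: (nyz (x + 2 * m%:~R)); last exact: markedD.
by rewrite -hy -hz kE intrM; lra.
Qed.

Lemma disjoint_classesC (A B : set (R -> mobius R)) :
  disjoint_classes A B -> disjoint_classes B A.
Proof.
move=> [g [h [Ag Bh gh]]]; exists h, g; split=> // r s Ir Is hg.
by have [] := gh s r Is Ir (esym hg).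
Qed.

(** Two different segments issued from (a, 1) meet only there, and their
    translates by nonzero even integers are too far away.  The images by odd
    glides ascend while the segments descend, and touch them at endpoints only.
    The bound [a + 2] is excluded because [cross_class a (a + 2)] is
    [cross_class a a]. *)
Lemma disjoint_cross_cross a c c' : marked t a -> marked t c -> marked t c' ->
  a <= c < a + 2 -> a <= c' < a + 2 -> c <> c' ->
  disjoint_classes (cross_class t a c) (cross_class t a c').
Proof.
move=> ma mc mc' ac ac' cc'; exists (cross_arc a c), (cross_arc a c').
split; [by apply: cross_arc_class => //; lra|by apply: cross_arc_class => //; lra|].
move=> r s; rewrite /= !in_itv/= => Ir Is /mobius_pt_eqP[m [[/= e1 e2]|[/= e1 e2]]].
  have sr : s = r by lra.
  subst s; have [m0|m1|m1] := @int_trichotomy R m; last 2 first.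
  - exfalso; nra.
  - exfalso; nra.
  have /eqP : r * (c' - c) = 0 by subst m; lra.
  rewrite mulf_eq0 => /orP[/eqP ->|]; first by split; left.
  by rewrite subr_eq0 => /eqP ?; exfalso; apply: cc'.
have rs : r = 1 - s by lra.
subst r.
have [m0|m1] : (0 <= (m%:~R : R)) \/ (m%:~R <= -1 :> R).
  by have [->|?|?] := @int_trichotomy R m; [left|left; lra|right].
- have s0 : s = 0 by nra.
  by split; [right|left]; lra.
- have s1 : s = 1 by nra.
  by split; [left|right]; lra.
Qed.

Lemma disjoint_cross_cap a b x : marked t a -> marked t b -> marked t x ->
  a < b < a + 2 -> (forall m : int, ~ a < x + 2 * m%:~R < b) ->
  disjoint_classes (cross_class t x x) (cap_class t a b).
Proof.
move=> ma mb mx ab nx; exists (cross_arc x x), (cap_arc a b).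
split; [by apply: cross_arc_class => //; lra|exact: cap_arc_class|].
move=> r s; rewrite /= !in_itv/= => Ir Is /mobius_pt_eqP[m [[/= e1 e2]|[/= e1 e2]]].
  have [xa|bx] : x + 2 * m%:~R <= a \/ b <= x + 2 * m%:~R.
    have := nx m; case: (leP (x + 2 * m%:~R) a) => [|ax]; first by left.
    by case: (leP b (x + 2 * m%:~R)) => [|xb]; [right|move=> []].
  - have s0 : s = 0 by nra.
    by subst s; split; left; lra.
  - have s1 : s = 1 by nra.
    by subst s; split; [left|right]; lra.
have [xa|bx] : x + 2 * m%:~R <= a \/ b <= x + 2 * m%:~R.
  have := nx m; case: (leP (x + 2 * m%:~R) a) => [|ax]; first by left.
  by case: (leP b (x + 2 * m%:~R)) => [|xb]; [right|move=> []].
- have s0 : s = 0 by nra.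
  by subst s; split; [right|left]; lra.
- have s1 : s = 1 by nra.
  by subst s; split; right; lra.
Qed.

(** The representatives of two disjoint classes may be reversed, so that their
    lifts have the prescribed endpoints; these lifts do not meet when they have
    no endpoint in common. *)
Lemma disjoint_lifts p q p' q' :
    disjoint_classes (arcs_joining t p q) (arcs_joining t p' q') ->
    p <> p' -> p <> q' -> q <> p' -> q <> q' ->
  exists L M : R -> R * R, [/\ continuous L /\ continuous M,
    L 0 = p /\ L 1 = q, M 0 = p' /\ M 1 = q',
    (forall s, I01 s -> `|(L s).2| <= 1) /\ (forall s, I01 s -> `|(M s).2| <= 1) &
    forall r s, I01 r -> I01 s -> L r <> M s].
Proof.
move=> [g0 [h0 [Ag Ah gh0]]] pp pq qp qq.
have orient z w f : arcs_joining t z w f -> exists f', [/\ joins f' z w,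
    f' @` I01 `<=` @strip R & f' = f \/ f' = reverse f].
  move=> [[[_ fS] _ _ _] [j|j]]; first by exists f; split=> //; left.
  exists (reverse f); split; [exact: joins_reverse|exact: reverse_strip|by right].
have [g [[L [cL L0 L1 LE]] gS gE]] := orient _ _ _ Ag.
have [h [[M [cM M0 M1 ME]] hS hE]] := orient _ _ _ Ah.
have gh : disjoint_arcs g h.
  move=> r s; rewrite /= !in_itv/= => Ir Is.
  have ends (x : R) : 1 - x = 0 \/ 1 - x = 1 -> x = 0 \/ x = 1.
    by move=> []; [right|left]; lra.
  have I_rev (x : R) : 0 <= x <= 1 -> I01 (1 - x) by rewrite /= in_itv/=; lra.
  case: gE => ->; case: hE => -> /gh0 gh; have [] := gh;
    rewrite ?/= ?in_itv//=; try exact: I_rev.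
  - by move=> ? /ends.
  - by move=> /ends.
  - by move=> /ends ? /ends.
exists L, M; split=> //.
  split=> s Is.
    by have : strip (g s) by [apply: gS; exists s]; rewrite LE// stripE.
  by have : strip (h s) by [apply: hS; exists s]; rewrite ME// stripE.
move=> r s Ir Is LM; have := gh r s Ir Is; rewrite LE// ME// LM => /(_ erefl).
by case=> -[] r01 [] s01; move: LM; rewrite r01 s01 ?L0 ?L1 ?M0 ?M1.
Qed.

Lemma disjoint_cross_le a c a' c' :
  disjoint_classes (cross_class t a c) (cross_class t a' c') -> a < a' -> c <= c'.
Proof.
move=> d aa; rewrite leNgt; apply/negP => cc.
have [||||L [M [[cL cM] [L0 L1] [M0 M1] [Ls Ms] LM]]] := disjoint_lifts d.
- by case=> ?; lra.
- by case=> ?; lra.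
- by case=> ?; lra.
- by case=> ?; lra.
by apply: (crossing_lines cL cM Ls Ms LM L0 L1 M0 M1) => //; lra.
Qed.

Lemma disjoint_cap_cross a b a' c' :
  disjoint_classes (cap_class t a b) (cross_class t a' c') -> ~ a < a' < b.
Proof.
move=> d aab.
have [||||L [M [[cL cM] [L0 L1] [M0 M1] [Ls Ms] LM]]] := disjoint_lifts d.
- by case=> ?; lra.
- by case=> ?; lra.
- by case=> ?; lra.
- by case=> ?; lra.
exact: (crossing_cap cL cM Ls Ms LM L0 L1 M0 M1 aab).
Qed.

Lemma cap_cross_neq a b a' c' : marked t a' -> marked t c' -> a' <= c' <= a' + 2 ->
  cap_class t a b <> cross_class t a' c'.
Proof.
move=> ma mc ac e; have := cross_arc_class ma mc ac.
by move=> g; have g' := g; rewrite -e in g'; exact: cap_cross_disjoint g' g.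
Qed.

Lemma cross_class_eq a c a' c' : marked t a -> marked t c -> a <= c <= a + 2 ->
    cross_class t a c = cross_class t a' c' -> exists m,
  (a' = a + 2 * m%:~R /\ c' = c + 2 * m%:~R) \/
  (a' = c + 2 * m%:~R /\ c' = a + 2 + 2 * m%:~R).
Proof.
move=> ma mc ac e; have := cross_arc_class ma mc ac.
rewrite e => -[_ [] /(joins_uniq (joins_cross_arc a c))[k [h1 h2]]];
  have [m [[kE sk]|[kE sk]]] := @signzE R k;
  move: h1 h2; rewrite /glide sk /= => -[h1 h1'] [h2 h2'];
  try by exfalso; lra.
  by exists m; left; move: h1 h2; rewrite kE intrM; lra.
by exists m; right; move: h1 h2; rewrite kE intrD intrM; lra.
Qed.
End ArcDisjointness.

(** * Vertices that survive all strong collapses *)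

Section UndominatedCore.
Context {V : Type}.
Implicit Types (X Y : set (set V)) (Q : set V).

(** The invariant of a sequence of collapses is that the current complex [X]
    still contains all the simplices of [Y] spanned by [Q]. *)
Lemma core_not_strongly_collapsible Y Q :
    (forall v, Q v -> Y [set v]) -> (exists v w, [/\ Q v, Q w & v <> w]) ->
    (forall v v', Q v -> v' <> v -> Y [set v; v'] ->
       exists w, [/\ Q w, w <> v, w <> v', Y [set v; w] & ~ Y [set v'; w]]) ->
  ~ strongly_collapsible Y.
Proof.
move=> YQ [v1 [v2 [Q1 Q2 v12]]] undom.
suff nc X : strongly_collapsible X -> X `<=` Y ->
    (forall s, Y s -> s `<=` Q -> X s) -> False by move=> cY; exact: (nc Y).
elim=> {X} [X v -> _ XQ|X v [Xv [v' [L [Xv' vv' _ _ linkE]]]] _ ih XY XQ].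
  have X1 u : Q u -> u = v.
    move=> Qu; have : [set [set v]] [set u] by apply: XQ; [exact: YQ|move=> _ ->].
    by move=> /= e; have : [set u] u by []; rewrite e.
  by apply: v12; rewrite (X1 v1 Q1) (X1 v2 Q2).
apply: ih => [s [/XY]//|s Ys sQ]; split; first exact: XQ.
move=> sv; have Qv := sQ _ sv.
have : join [set [set v']] L [set v'] by constructor 1.
rewrite -linkE => -[_ _ Xvv'].
have [w [Qw wv wv' Yvw Yvw']] := undom v v' Qv vv' (XY _ Xvv').
have : link X v [set w].
  split; first by apply: XQ; [exact: YQ|move=> _ ->].
    by move=> /= e; exact/wv/esym.
  by apply: XQ => // u [->|->].
rewrite linkE => -[/= e|Lw|[x [y [/= -> _ e]]]].
- by apply: wv'; have : [set w] w by []; rewrite e.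
- have : join [set [set v']] L ([set v'] `|` [set w]).
    by constructor 3; exists [set v'], [set w].
  by rewrite -linkE => -[/XY].
- by apply: wv'; have : [set w] v' by rewrite e; left.
Qed.
End UndominatedCore.

(** * The core of the arc complex of the crown *)

Section Crown.
Context {R : realType} {n : nat} (t : 'I_n -> R).
Hypotheses (hn : (4 <= n)%N) (ht : cyclic_marking t).
Implicit Types (a b c l x y : R) (m : int) (A B : set (R -> mobius R)).

Local Notation marked := (marked t).
Local Notation cross := (cross_class t).
Local Notation cap := (cap_class t).

Definition same_vertex x y := exists m, y = x + 2 * m%:~R.

Lemma same_vertex_sym x y : same_vertex x y -> same_vertex y x.
Proof. by move=> [m ->]; exists (- m); rewrite mulrNz; ring. Qed.

Lemma same_vertex_trans y x z : same_vertex x y -> same_vertex y z -> same_vertex x z.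
Proof. by move=> [m ->] [l ->]; exists (m + l); rewrite intrD; ring. Qed.

Lemma same_vertex_near x y : same_vertex x y -> ~ x < y < x + 2.
Proof. by move=> [m ->]; have [->|?|?] := @int_trichotomy R m; lra. Qed.

Lemma shift_into a x : exists m, a <= x + 2 * m%:~R < a + 2.
Proof.
exists (- Num.floor ((x - a) / 2)); rewrite mulrNz.
have := ge_floor ((x - a) / 2); have := lt_succ_floor ((x - a) / 2).
by rewrite intrD; lra.
Qed.

Lemma same_vertex_index i j : same_vertex (t i) (t j) -> i = j.
Proof.
case: ht => t02 tlt s; apply/eqP; rewrite eq_le !leNgt; apply/andP.
have [i0 j0] := (t02 i, t02 j).
split; apply/negP => ij; [have := @same_vertex_near _ _ (same_vertex_sym s)|
  have := @same_vertex_near _ _ s]; have := tlt _ _ ij; lra.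
Qed.

(** This is where [4 <= n] is used. *)
Lemma fresh_vertex x y z : marked x -> marked y -> marked z ->
  exists2 w, marked w & [/\ ~ same_vertex x w, ~ same_vertex y w & ~ same_vertex z w].
Proof.
move=> [i [mi ->]] [j [mj ->]] [k [mk ->]].
have [w wP] : exists w, w \notin [:: i; j; k].
  apply: contrapT => all_in; have := hn; rewrite leqNgt => /negP; apply.
  have : {subset enum 'I_n <= [:: i; j; k]}.
    by move=> w _; apply: contraT => wn; case: all_in; exists w.
  by move/(uniq_leq_size (enum_uniq _)); rewrite size_enum_ord.
exists (t w); first by exists w, 0; rewrite mulr0 addr0.
move: wP; rewrite !inE !negb_or => /and3P[wi wj wk].
have ne u mu : w != u -> ~ same_vertex (t u + 2 * mu%:~R) (t w).
  move=> wu [m e]; move/eqP: wu; apply; apply/esym/same_vertex_index.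
  by exists (mu + m); rewrite e intrD; ring.
by split; apply: ne.
Qed.

Lemma next_vertex x : marked x -> exists y, [/\ marked y, x < y &
  forall z, marked z -> x < z -> y <= z].
Proof.
move=> [i [k ->]]; case: ht => t02 _.
pose f j := if t i < t j then t j else t j + 2.
have fi j : t i < f j.
  by rewrite /f; case: (ltP (t i) (t j)) => //; have := t02 i; have := t02 j; lra.
case: (@Order.TotalTheory.arg_minP _ _ _ i xpredT f erefl) => j _ jmin.
exists (f j + 2 * k%:~R); split.
- apply: markedD; rewrite /f; case: ifP => _; first by exists j, 0; rewrite mulr0 addr0.
  by exists j, 1; rewrite mulr1.
- by have := fi j; lra.
- move=> _ [j' [k' ->]] lt.
  have : f j' <= t j' + 2 * (k' - k)%:~R.
    have lt' : t i < t j' + 2 * (k' - k)%:~R by rewrite intrB; lra.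
    have [ti tj] := (t02 i, t02 j'); rewrite /f; case: (ltP (t i) (t j')) => h.
      by move: lt'; have [->|?|?] := @int_trichotomy R (k' - k); lra.
    by move: lt'; have [->|?|?] := @int_trichotomy R (k' - k); lra.
  by have := jmin j' isT; rewrite intrB; lra.
Qed.

Lemma prev_vertex x : marked x -> exists y, [/\ marked y, y < x &
  forall z, marked z -> z < x -> z <= y].
Proof.
move=> [i [k ->]]; case: ht => t02 _.
pose f j := if t j < t i then t j else t j - 2.
have fi j : f j < t i.
  by rewrite /f; case: (ltP (t j) (t i)) => //; have := t02 i; have := t02 j; lra.
case: (@Order.TotalTheory.arg_maxP _ _ _ i xpredT f erefl) => j _ jmax.
exists (f j + 2 * k%:~R); split.
- apply: markedD; rewrite /f; case: ifP => _; first by exists j, 0; rewrite mulr0 addr0.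
  by exists j, (-1); rewrite mulrN1.
- by have := fi j; lra.
- move=> _ [j' [k' ->]] lt.
  have : t j' + 2 * (k' - k)%:~R <= f j'.
    have lt' : t j' + 2 * (k' - k)%:~R < t i by rewrite intrB; lra.
    have [ti tj] := (t02 i, t02 j'); rewrite /f; case: (ltP (t j') (t i)) => h.
      by move: lt'; have [->|?|?] := @int_trichotomy R (k' - k); lra.
    by move: lt'; have [->|?|?] := @int_trichotomy R (k' - k); lra.
  by have jm : f j' <= f j := jmax j' isT; move: jm; rewrite intrB; lra.
Qed.

Definition ear a l b := [/\ marked a, marked l, marked b, a < l < b &
  b < a + 2 /\ forall x, marked x -> a < x < b -> x = l].

(** The neighbours of [l] on both sides.  They are less than a full turn
    apart because there is a vertex other than [l] and than the left
    neighbour. *)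
Lemma exists_ear l : marked l -> exists a b, ear a l b.
Proof.
move=> ml; have [b [mb lb nextb]] := next_vertex ml.
have [a [ma al preva]] := prev_vertex ml.
have only x : marked x -> a < x < b -> x = l.
  move=> mx axb; have [lx|xl|//] := ltgtP l x.
    by have := nextb x mx lx; lra.
  by have := preva x mx xl; lra.
exists a, b; split=> //; first by lra.
split=> //; have [y my [nly nay _]] := fresh_vertex ml ma ma.
have [k] := shift_into l y; set y' := y + _ => y'l.
have my' : marked y' by exact: markedD.
have ly' : l < y'.
  rewrite lt_neqAle; apply/andP; split; last by lra.
  by apply/eqP => e; apply: nly; apply: same_vertex_sym; exists k.
have by' := nextb y' my' ly'.
have a2 := preva _ (markedD (-1) my'); rewrite mulrN1 in a2.
have ya : y' - 2 <= a by apply: a2; lra.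
rewrite lt_neqAle; apply/andP; split; last by lra.
apply/eqP => e; apply: nay; apply: same_vertex_sym; exists (k - 1).
rewrite intrB; rewrite /y' in ya by'; lra.
Qed.

Definition core : set (set (R -> mobius R)) := [set A |
  (exists a c, [/\ marked a, marked c, a <= c < a + 2 & A = cross a c]) \/
  (exists a l b, ear a l b /\ A = cap a b)].

Lemma core_arc_class A : core A -> arc_classes t A.
Proof.
move=> [[a [c [ma mc ac ->]]]|[a [l [b [[ma ml mb alb [ba _]] ->]]]]].
  by apply: cross_class_arc => //; lra.
exact: cap_class_arc ma mb ml alb ba.
Qed.

Lemma core_cross a c : marked a -> marked c -> a <= c < a + 2 -> core (cross a c).
Proof. by move=> ma mc ac; left; exists a, c. Qed.

Lemma cross_loop m x : cross (x + 2 * m%:~R) (x + 2 * m%:~R) = cross x x.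
Proof. exact: cross_classD. Qed.

Lemma disjoint_cap_crossD a b x c m :
  disjoint_classes (cap a b) (cross x c) -> ~ a < x + 2 * m%:~R < b.
Proof. by rewrite -(@cross_classD _ _ _ m); exact: disjoint_cap_cross. Qed.

Definition compatible A B := A = B \/ disjoint_classes A B.

(** The lifts of the crossing loop at [x] form a zigzag through the points over
    [x] on the two boundary lines.  A lift of a crossing arc disjoint from it that
    starts strictly between two consecutive such points of the line y = 1 has to
    end at the point of the line y = -1 between them. *)
Lemma compatible_loop x a c : marked x ->
  compatible (cross x x) (cross a c) -> same_vertex x a \/ same_vertex x c.
Proof.
move=> mx [/(@cross_class_eq _ _ _ _ _ _ _ mx mx)|d].
  by case=> [|m [[-> _]|[-> _]]]; [lra|left; exists m|left; exists m].
have [m] := shift_into (a - 2) x; set y := x + _ => ya.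
have [ya'|ay] := eqVneq y (a - 2).
  by left; exists (m + 1); rewrite intrD; rewrite /y in ya'; lra.
have {}ya : a - 2 < y < a by rewrite lt_neqAle eq_sym ay; lra.
have d1 : disjoint_classes (cross y (y + 2)) (cross a c).
  by rewrite cross_classC cross_loop.
have d2 : disjoint_classes (cross a c) (cross (y + 2) (y + 2)).
  by rewrite -[2]mulr1 (cross_loop 1) cross_loop; exact: disjoint_classesC.
have := disjoint_cross_le d1; have := disjoint_cross_le d2 => h2 h1.
have {h1 h2} cE : c = y + 2 by have := h1 ltac:(lra); have := h2 ltac:(lra); lra.
by right; exists (m + 1); rewrite cE intrD /y; ring.
Qed.

Lemma disjoint_loop_range a c :
  disjoint_classes (cross a a) (cross a c) -> a <= c <= a + 2.
Proof.
move=> d; have d1 : disjoint_classes (cross (a - 2) (a - 2 + 2)) (cross a c).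
  by rewrite cross_classC -[a - 2](_ : a + 2 * (-1)%:~R = _) ?cross_loop// mulrN1.
have d2 : disjoint_classes (cross a c) (cross (a + 2) (a + 2)).
  by rewrite -[2]mulr1 (cross_loop 1); exact: disjoint_classesC.
by have := disjoint_cross_le d1 ltac:(lra); have := disjoint_cross_le d2 ltac:(lra); lra.
Qed.

(** An arc and its reverse are in the same class, and one of them has a lift
    starting at [(x, 1)]. *)
Lemma rebase x a c : marked a -> marked c -> same_vertex x a \/ same_vertex x c ->
  exists2 c', marked c' & cross a c = cross x c'.
Proof.
move=> ma mc [] [m E]; rewrite E.
  exists (c - 2 * m%:~R); first by have := markedD (- m) mc; rewrite mulrNz mulrN.
  by rewrite -[RHS](@cross_classD _ _ _ m) subrK.
exists (a + 2 - 2 * m%:~R).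
  by have := markedD (1 - m) ma; rewrite intrB mulrBr mulr1 addrA.
by rewrite -cross_classC -[RHS](@cross_classD _ _ _ m) subrK.
Qed.

Section Domination.
Variables v v' : set (R -> mobius R).
Hypotheses (av' : arc_classes t v') (vv' : v' <> v) (dv : disjoint_classes v v').
(* [v'] would dominate [v] in a complex that contains the core. *)
Hypothesis dom : forall w, core w -> w <> v -> disjoint_classes v w -> compatible w v'.

(** The witness is the crossing arc from [a] to a vertex [x] cut off by the
    cap. *)
Lemma cross_not_dominated_by_cap a c al be x : marked a -> marked c -> a <= c < a + 2 ->
  v = cross a c -> marked x -> al < x < be -> v' = cap al be -> False.
Proof.
move=> ma mc ac vE mx alx v'E.
have [m x'] := shift_into a x; have mx' := markedD m mx.
have : disjoint_classes (cap al be) (cross a (x + 2 * m%:~R)).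
  have [xc|xc] := pselect (x + 2 * m%:~R = c).
    by rewrite -v'E xc -vE; exact: disjoint_classesC.
  have wv : cross a (x + 2 * m%:~R) <> v.
    move=> e; rewrite vE in e.
    have [k [[h1 h2]|[h1 h2]]] := cross_class_eq ma mx' ltac:(lra) e.
      by apply: xc; lra.
    by have [k0|k1|k1] := @int_trichotomy R k; [subst k|..]; lra.
  have [|e|d] := dom (core_cross ma mx' x') wv.
  - by rewrite vE; apply: disjoint_cross_cross => // e; exact/xc/esym.
  - exfalso; apply: (@cap_cross_neq _ _ t al be a (x + 2 * m%:~R)) => //; first by lra.
    by rewrite -v'E.
  - by rewrite -v'E; exact: disjoint_classesC.
rewrite -cross_classC => d; apply: (@disjoint_cap_crossD _ _ _ _ (- m) d).
by rewrite mulrNz mulrN addrK.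
Qed.

(** The witnesses are the crossing loops at the two ends of the arc. *)
Lemma chord_not_dominated_by_cross a c al ga : marked a -> marked c -> a < c < a + 2 ->
  v = cross a c -> marked al -> marked ga -> v' = cross al ga -> False.
Proof.
move=> ma mc ac vE mal mga v'E.
have nca : ~ same_vertex c a by move=> /same_vertex_sym/same_vertex_near.
have loop_compatible x : marked x -> cross x x <> v ->
    disjoint_classes v (cross x x) -> compatible (cross x x) v'.
  by move=> mx; apply: dom; apply: core_cross => //; lra.
have ca_v' : compatible (cross a a) v'.
  apply: loop_compatible => //.
    rewrite vE => e.
    have [m [[h1 h2]|[h1 h2]]] := cross_class_eq ma ma ltac:(lra) e; first by lra.
    by have [k0|k1|k1] := @int_trichotomy R m; [subst m|..]; lra.
  by rewrite vE; apply: disjoint_cross_cross => //; lra.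
have ma2 : marked (a + 2) by rewrite -[2]mulr1; exact: (markedD 1 ma).
have cc_v' : compatible (cross c c) v'.
  apply: loop_compatible => //.
    rewrite vE => e.
    by have [m [[h1 h2]|[h1 h2]]] := cross_class_eq mc mc ltac:(lra) e; lra.
  by rewrite vE -cross_classC; apply: disjoint_cross_cross => //; lra.
rewrite v'E in ca_v' cc_v'.
have [g mg gE] := rebase mal mga (compatible_loop ma ca_v').
rewrite gE in ca_v' cc_v'.
have [//|[m gc]] := compatible_loop mc cc_v'.
case: ca_v' => [e|/disjoint_loop_range ag].
  apply: nca; have [k [[_ h]|[_ h]]] := cross_class_eq ma ma ltac:(lra) e.
    by exists (m - k); rewrite intrB; lra.
  by exists (m - k - 1); rewrite !intrB; lra.
have [m0|m1|m1] := @int_trichotomy R m; [subst m|lra|lra].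
by apply: vv'; rewrite v'E vE gE gc mulr0 addr0.
Qed.

(** The witness is the ear around the other end of the crossing arc. *)
Lemma loop_not_dominated_by_cross a al ga : marked a ->
  v = cross a a -> marked al -> marked ga -> v' = cross al ga -> False.
Proof.
move=> ma vE mal mga v'E.
have d : disjoint_classes (cross a a) (cross al ga) by rewrite -vE -v'E.
have [g mg gE] := rebase mal mga (compatible_loop ma (or_intror d)).
rewrite gE in d v'E; have ag := disjoint_loop_range d.
have ga0 : g <> a by move=> e; apply: vv'; rewrite v'E vE e.
have ga2 : g <> a + 2 by move=> e; apply: vv'; rewrite v'E vE e cross_classC.
have {}ag : a < g < a + 2.
  by rewrite !lt_neqAle; move/eqP: ga0; move/eqP: ga2 => -> ; rewrite eq_sym => -> /=.
have [p [q pgq]] := exists_ear mg; have [mp _ mq gpq [qp only]] := pgq.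
have ear_core : core (cap p q) by right; exists p, g, q.
have [||e|dw] := dom ear_core.
- by rewrite vE; apply: cap_cross_neq => //; lra.
- rewrite vE; apply: disjoint_cross_cap => //; first by lra.
  move=> m am; have := only _ (markedD m ma) am.
  by move=> e; apply: (@same_vertex_near a g) => //; exists m.
- move: e; rewrite v'E -cross_classC; apply: cap_cross_neq => //; last by lra.
  by rewrite -[2]mulr1; exact: (markedD 1 ma).
- by move: dw; rewrite v'E -cross_classC => /disjoint_cap_cross.
Qed.

(** The witness is the crossing loop at a vertex which is neither [l] nor an end
    of the crossing arc. *)
Lemma ear_not_dominated_by_cross a l b al ga : ear a l b ->
  v = cap a b -> marked al -> marked ga -> v' = cross al ga -> False.
Proof.
move=> [ma ml mb alb [ba only]] vE mal mga v'E.
have [k mk [nl na nc]] := fresh_vertex ml mal mga.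
have [||w|w] := dom (core_cross mk mk ltac:(lra)).
- by rewrite vE => /esym; apply: cap_cross_neq => //; lra.
- rewrite vE; apply/disjoint_classesC/disjoint_cross_cap => //; first by lra.
  move=> m km; apply/nl/same_vertex_sym; exists m.
  by rewrite (only _ (markedD m mk) km).
- have : compatible (cross k k) (cross al ga) by left; rewrite w.
  by case/(compatible_loop mk) => /same_vertex_sym.
- have : compatible (cross k k) (cross al ga) by right; rewrite -v'E.
  by case/(compatible_loop mk) => /same_vertex_sym.
Qed.

(** The witness is the crossing loop at a vertex other than [l] cut off by
    the cap; the only cap without such a vertex is the ear itself. *)
Lemma ear_not_dominated_by_cap a l b al be x : ear a l b -> v = cap a b ->
  marked al -> marked be -> marked x -> al < x < be -> v' = cap al be -> False.
Proof.
move=> [ma ml mb alb [ba only]] vE mal mbe mx alx v'E.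
have only_l y : marked y -> al < y < be -> same_vertex y l.
  move=> my aly; apply: contrapT => nyl.
  have [||e|d] := dom (core_cross my my ltac:(lra)).
  - by rewrite vE => /esym; apply: cap_cross_neq => //; lra.
  - rewrite vE; apply/disjoint_classesC/disjoint_cross_cap => //; first by lra.
    move=> m ym; apply: nyl; exists m.
    by rewrite (only _ (markedD m my) ym).
  - by move: e; rewrite v'E => /esym; apply: cap_cross_neq => //; lra.
  - by move: d; rewrite v'E => /disjoint_classesC/disjoint_cap_cross.
have [m lE] := only_l x mx alx.
have {}v'E : v' = cap (al + 2 * m%:~R) (be + 2 * m%:~R) by rewrite cap_classD.
have only_l' y : marked y -> al + 2 * m%:~R < y < be + 2 * m%:~R -> same_vertex y l.
  move=> my aly; apply: (@same_vertex_trans (y - 2 * m%:~R)).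
    by exists (- m); rewrite mulrNz mulrN.
  apply: only_l; last by lra.
  by have := markedD (- m) my; rewrite mulrNz mulrN.
have {mal mbe} [mal mbe] := (markedD m mal, markedD m mbe).
have : al + 2 * m%:~R < l < be + 2 * m%:~R by rewrite lE; lra.
move: (al + _) (be + _) v'E only_l' mal mbe => p q v'E only_l' mp mq plq.
have na : ~ same_vertex a l by move=> /same_vertex_near; lra.
have nb : ~ same_vertex b l by move=> /same_vertex_sym/same_vertex_near; lra.
have pa : p = a.
  have [lt_pa|lt_ap|//] := ltgtP p a.
    by exfalso; apply/na/only_l' => //; lra.
  by have := only p mp ltac:(lra); lra.
have qb : q = b.
  have [lt_qb|lt_bq|//] := ltgtP q b.
    by have := only q mq ltac:(lra); lra.
  by exfalso; apply/nb/only_l' => //; lra.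
by apply: vv'; rewrite v'E pa qb vE.
Qed.

Lemma core_undominated : core v -> False.
Proof.
move=> cv; case: (arc_classes_joining av')
  => [[al [be [x [mal mbe mx alx v'E]]]]|[al [ga [mal mga v'E]]]];
  case: cv => [[a [c [ma mc ac vE]]]|[a [l [b [alb vE]]]]].
- exact: cross_not_dominated_by_cap vE mx alx v'E.
- exact: ear_not_dominated_by_cap alb vE mal mbe mx alx v'E.
- have [ca|ca] := pselect (c = a).
    by rewrite ca in vE; exact: loop_not_dominated_by_cross vE mal mga v'E.
  apply: chord_not_dominated_by_cross ma mc _ vE mal mga v'E.
  by rewrite lt_neqAle; move/eqP: ca; rewrite eq_sym => -> /=.
- exact: ear_not_dominated_by_cross alb vE mal mga v'E.
Qed.
End Domination.

Lemma arc_complex1 A : arc_classes t A -> arc_complex t [set A].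
Proof.
move=> tA; split=> [|||B C -> -> //]; [exact: finite_set1|by exists A|by move=> _ ->].
Qed.

Lemma arc_complex2 A B : arc_classes t A -> arc_classes t B ->
  disjoint_classes A B -> arc_complex t [set A; B].
Proof.
move=> tA tB AB; split.
- by rewrite finite_setU; split; exact: finite_set1.
- by exists A; left.
- by move=> _ [->|->].
- by move=> C D [->|->] [->|->] // _; exact: disjoint_classesC.
Qed.

Lemma arc_complex2_disjoint A B : A <> B ->
  arc_complex t [set A; B] -> disjoint_classes A B.
Proof. by move=> AB [_ _ _ d]; apply: d => //; [left|right]. Qed.

Lemma crown_not_strongly_collapsible : ~ strongly_collapsible (arc_complex t).
Proof.
apply: (@core_not_strongly_collapsible _ _ core).
- by move=> A /core_arc_class; exact: arc_complex1.
- pose i : 'I_n := Ordinal (leq_trans (isT : 0 < 4)%N hn).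
  have mi : marked (t i) by exists i, 0; rewrite mulr0 addr0.
  have [a [b alb]] := exists_ear mi.
  exists (cap a b), (cross (t i) (t i)); split.
  + by right; exists a, (t i), b.
  + by apply: core_cross => //; lra.
  + by apply: cap_cross_neq => //; lra.
- move=> v v' cv vv' Yvv'.
  have av' : arc_classes t v' by case: Yvv' => _ _ + _; apply; right.
  have dv : disjoint_classes v v' by apply: arc_complex2_disjoint Yvv'; exact/nesym.
  apply: contrapT => nw; apply: (@core_undominated v v' av' vv' dv _ cv).
  move=> w cw wv dvw; have [->|wv'] := pselect (w = v'); first by left.
  right; apply: contrapT => ndw; apply: nw; exists w; split=> //.
    by apply: arc_complex2 => //; exact: core_arc_class.
  by move=> /(@arc_complex2_disjoint _ _ (nesym wv'))/disjoint_classesC.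
Qed.
End Crown.

Theorem theorem3 (R : realType) (n : nat) (t : 'I_n -> R)
  (hn : (4 <= n)%N) (ht : cyclic_marking t) :
  ~ strongly_collapsible (arc_complex t).
Proof. exact: crown_not_strongly_collapsible. Qed.
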